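(* Let $p$, $\alpha$ and $\lambda$ be given numbers such that $1\le p\le\infty$, $0<\lambda<2$, and $$\tfrac12<\alpha\le 1\quad\text{for } p=1,$$ $$1-\tfrac1{2p}<\alpha<\tfrac32-\tfrac1{2p}\quad\text{for } 1<p<\infty,$$ $$1\le\alpha<\tfrac32\quad\text{for } p=\infty.$$ Then there exists a constant $C$, not depending on $f$ and $n$, such that for every $f\in L_{p,\alpha}$ and every positive integer $n$, $$\hat\omega\left(f,\tfrac1n\right)_{p,\alpha}\le\frac{C}{n^2}\sum_{\nu=1}^n \nu\,E_\nu(f)_{p,\alpha}.$$
   Context: For $1\le p\le\infty$, $L_p$ denotes the set of functions $f$ measurable on $[-1,1]$ such that $\|f\|_p<\infty$, where $\|f\|_p=\left(\int_{-1}^1|f(x)|^p\,dx\right)^{1/p}$ for $1\le p<\infty$ and $\|f\|_\infty=\operatorname{ess\,sup}_{-1\le x\le 1}|f(x)|$ for $p=\infty$. $L_{p,\alpha}$ denotes the set of functions $f$ such that $f(x)(1-x^2)^\alpha\in L_p$, and $\|f\|_{p,\alpha}=\|f(x)(1-x^2)^\alpha\|_p$. For $f\in L_{p,\alpha}$ and a positive integer $n$, $E_n(f)_{p,\alpha}=\inf_{P_n}\|f-P_n\|_{p,\alpha}$, where the infimum is over all algebraic polynomials $P_n$ of degree not greater than $n-1$. The (asymmetric) operator of generalised translation is defined by $$\hat T_t(f,x)=\frac1{\pi(1-x^2)}\int_0^\pi\Big(1-\big(x\cos t-\sqrt{1-x^2}\,\sin t\cos\varphi\big)^2-2\sin^2t\,\sin^2\varphi+4(1-x^2)\sin^2t\,\sin^4\varphi\Big)\,f\big(x\cos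 t-\sqrt{1-x^2}\,\sin t\cos\varphi\big)\,d\varphi .$$ The generalised modulus of smoothness is $$\hat\omega(f,\delta)_{p,\alpha}=\sup_{|t|\le\delta}\big\|\hat T_t(f,x)-f(x)\big\|_{p,\alpha},$$ where the norm is taken with respect to $x$. *)

(* Defs.v *)
From mathcomp Require Import all_boot all_order all_algebra.
From mathcomp Require Import all_classical all_reals all_analysis.

Set Implicit Arguments.
Unset Strict Implicit.
Unset Printing Implicit Defensive.

Import Order.TTheory GRing.Theory Num.Theory.
Import numFieldNormedType.Exports.

Local Open Scope classical_set_scope.
Local Open Scope ring_scope.
Local Open Scope ereal_scope.

(* The real line with the sigma-algebra of Lebesgue (Caratheodory) measurable
   sets: the default sigma-algebra on [R], on which [lebesgue_measure] is
   defined, only contains the Borel sets. *)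
Notation lebesgueType R :=
  (caratheodory_type (lebesgue_stieltjes_measure.wlength (@idfun R))^*%mu).

Section GeneralisedModulus.
Variable R : realType.
Implicit Types (p : \bar R) (alpha delta t x phi : R) (n : nat).

Definition unit_segment : set (lebesgueType R) := `[(-1)%R : R, 1%R].

(* Extending by 0 outside [-1, 1] also gives the right value for p = +oo,
   because the essential supremum is that of a nonnegative function. *)
Definition Lp_norm p (g : R -> \bar R) : \bar R :=
  Lnorm (@completed_lebesgue_measure R) p (g \_ unit_segment).

Definition jacobi_weight alpha x : R := (1 - x ^+ 2) `^ alpha.

Definition weighted_norm p alpha (g : R -> \bar R) : \bar R :=
  Lp_norm p (fun x => g x * (jacobi_weight alpha x)%:E).

Definition in_L p (f : R -> R) : Prop :=
  measurable_fun unit_segment (f : lebesgueType R -> R) /\ Lp_norm p (EFin \o f) < +oo.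

Definition in_Lw p alpha (f : R -> R) : Prop :=
  in_L p (fun x => f x * jacobi_weight alpha x)%R.

(* [size P <= n] means deg P <= n - 1. *)
Definition best_approx p alpha (f : R -> R) n : \bar R :=
  ereal_inf [set weighted_norm p alpha (fun x => (f x - P.[x])%:E)
            | P in [set P : {poly R} | (size P <= n)%N]].

Definition trans_arg t x phi : R :=
  (x * cos t - Num.sqrt (1 - x ^+ 2) * sin t * cos phi)%R.

Definition trans_kernel t x phi : R :=
  (1 - trans_arg t x phi ^+ 2 - 2 * sin t ^+ 2 * sin phi ^+ 2
     + 4 * (1 - x ^+ 2) * sin t ^+ 2 * sin phi ^+ 4)%R.

(* The integral is extended-real valued, so that no spurious finite value is
   assigned at points x where it diverges. *)
Definition gen_translation t (f : R -> R) x : \bar R :=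
  (pi * (1 - x ^+ 2))^-1%:E *
  \int[@completed_lebesgue_measure R]_(phi in (`[0%R : R, pi] : set (lebesgueType R)))
    (trans_kernel t x phi * f (trans_arg t x phi))%:E.

Definition gen_modulus p alpha (f : R -> R) delta : \bar R :=
  ereal_sup [set weighted_norm p alpha (fun x => gen_translation t f x - (f x)%:E)
            | t in [set t : R | (`|t| <= delta)%R]].

End GeneralisedModulus.

(* Main.v *)
(** Geometrically, [trans_arg t x phi] runs over the heights of a circle of
    spherical radius [t] about a point of height [x]. The spherical law of sines
    gives [|trans_kernel t x phi| <= 5 (1 - y ^ 2)] at [y = trans_arg t x phi], so
    the translate of [f] is at most [5 / (pi (1 - x ^ 2))] times the circle mean
    of [|f(y)| (1 - y ^ 2)]. The circle mean is a self-adjoint integral operator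
    which maps [(1 - y ^ 2) ^ (- e)], [0 <= e < 1/2], into a multiple of
    [(1 - x ^ 2) ^ (- e)]; Hoelder's inequality (a Schur test) then makes the
    translations bounded on the weighted space, uniformly in [t].

    For a polynomial [Q] of degree less than [m], the translate of [Q] at fixed [x]
    is a polynomial of degree at most [N = m + 2] in [cos t]. Lagrange
    interpolation at the nodes [(1 + cos (j pi / N)) / 2] expresses its increment
    from [t = 0] as a combination of translates of [Q] whose weights sum in absolute
    value to at most [8 N ^ 2 (1 - cos t)]: a Bernstein inequality
    [||T_t Q - Q|| <= C m ^ 2 t ^ 2 ||Q||] without differentiating anything.
    Telescoping it over differences of nearly best approximations of degrees
    [2 ^ j] gives the theorem. *)

Require Import Defs.
From mathcomp Require Import all_boot all_order all_algebra.
From mathcomp Require Import all_classical all_reals all_analysis.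
From mathcomp Require Import measurable_realfun ess_sup_inf.
From mathcomp Require Import ring lra.

Set Implicit Arguments.
Unset Strict Implicit.
Unset Printing Implicit Defensive.

Import Order.TTheory GRing.Theory Num.Theory.
Import numFieldNormedType.Exports.

Local Open Scope classical_set_scope.
Local Open Scope ring_scope.

(** The range of [alpha] is what the Schur test consumes. Write [alpha - 1 = delta - kappa] with
    [delta, kappa >= 0]. Hoelder's inequality asks for circle means of [(1 - y ^ 2) ^ (- p' delta)],
    [p'] conjugate to [p], and self-adjointness for those of [(1 - y ^ 2) ^ (- p kappa)]; both are
    controlled only if [p' delta] and [p kappa] are below 1/2. For [1 < p < +oo] these are the upper
    and the lower bound on [alpha].

    The nodes fill [0, 1] and not [-1, 1] because [cos t = -1] forces [sin t = 0]: the circle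
    shrinks to a point, the mean has no kernel, and the bound on translates is lost. The node 1 has
    the same defect, but there the translation is the identity.

    Substitution and Tonelli are carried out for Borel functions, while [f] is Lebesgue measurable
    at best. It is replaced by a Borel function equal to it off a null set. For [sin t != 0] the
    heights on a circle have a density, so the translates of both functions agree at every point of
    ]-1, 1[, not just at almost every one. *)

(** * Change of variables for nonnegative measurable functions *)

Section substitution.
Variables (R : realType) (F f : R -> R) (a b : R).
Notation mu := (@lebesgue_measure R).
Hypothesis ab : a < b.
Hypothesis dF : forall x : R, is_derive x 1 F (f x).
Hypothesis cf : continuous f.
Hypothesis f_gt0 : forall x, x \in `]a, b[ -> 0 < f x.

Let cF : continuous F.
Proof.
move=> x; apply: differentiable_continuous; apply/derivable1_diffP.
by have [] := dF x.
Qed.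

Let F_incr x y : a <= x -> x < y -> y <= b -> F x < F y.
Proof.
move=> ax xy yb.
have [|c cxy] := @MVT R F f x y xy (fun z _ => dF z).
  exact: continuous_subspaceT.
move=> /eqP; rewrite subr_eq => /eqP ->; rewrite ltrDr mulr_gt0 ?subr_gt0//.
move: cxy; rewrite in_itv/= => /andP[xc cy]; apply: f_gt0; rewrite in_itv/=.
by rewrite (le_lt_trans ax xc) (lt_le_trans cy yb).
Qed.

Let F_mono x y : a <= x <= b -> a <= y <= b -> (F x <= F y) = (x <= y).
Proof.
move=> /andP[ax xb] /andP[ay yb]; case: (ltgtP x y) => [xy|yx|->].
- by rewrite ltW// F_incr.
- by apply/negbTE; rewrite -ltNge F_incr.
- by rewrite lexx.
Qed.

Let F_smono x y : a <= x <= b -> a <= y <= b -> (F x < F y) = (x < y).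
Proof. by move=> xab yab; rewrite !ltNge F_mono. Qed.

Let mF : measurable_fun setT F. Proof. exact: continuous_measurable_fun. Qed.
Let mf : measurable_fun setT f. Proof. exact: continuous_measurable_fun. Qed.

Notation GR := (measurableTypeR R).

(** On [D], the push-forward of planar Lebesgue measure under [G] is the image under [F] of the
    measure with density [f]: the fibre over [x] is the segment [[0, f x]]. The rest of the plane is
    sent to [F b + 1], a point outside [D]. *)
Let G (z : GR * GR) : GR :=
  if (a < z.1 < b) && (0 <= z.2 <= f z.1) then F z.1 else F b + 1.

Let mG : measurable_fun [set: GR * GR] G.
Proof.
suff : measurable_fun [set: R * R] (G : R * R -> R) by [].
apply: measurable_fun_ifT => //=.
- apply: measurable_and; apply: measurable_and.
  + by apply: measurable_fun_ltr.
  + by apply: measurable_fun_ltr.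
  + by apply: measurable_fun_ler.
  + by apply: measurable_fun_ler => //; exact: measurableT_comp.
- exact: measurableT_comp.
Qed.

Let D : set GR := `[F a, F b].

Let m1 := pushforward (mu \x mu)%E G.

Let integral_m1 (h : R -> \bar R) : measurable_fun setT h ->
  (forall y, 0 <= h y)%E ->
  (\int[m1]_(y in D) h y = \int[mu]_(x in `[a, b]) (h (F x) * (f x)%:E))%E.
Proof.
move=> mh h0; rewrite /m1.
have mD : measurable D by exact: measurable_itv.
have DE z : D z = (F a <= z <= F b)%R :> Prop by rewrite /D /= in_itv.
rewrite (ge0_integral_pushforward mG)//=; last first.
  exact: measurable_funTS.
have mGD : measurable (G @^-1` D).
  by rewrite -[X in measurable X]setTI; exact: mG.
have mhG : measurable_fun [set: GR * GR] (h \o G).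
  by apply: measurableT_comp mG => //; exact: mh.
rewrite integral_mkcond fubini_tonelli1//=; last 2 first.
- by apply/(measurable_restrictT _ mGD); exact: measurable_funTS.
- by move=> z; rewrite erestrict_ge0.
rewrite [RHS]integral_itv_bndoo; last first.
  apply: measurable_funTS; apply: emeasurable_funM.
    exact: measurableT_comp.
  exact/measurable_EFinP.
rewrite [RHS]integral_mkcond; apply: eq_integral => x _.
rewrite /fubini_F [RHS]/patch; case: ifPn => [|xab].
- rewrite inE/= in_itv/= => axb; have /andP[ax xb] := axb.
  have fx0 : 0 <= f x by rewrite ltW// f_gt0// in_itv/= axb.
  have FxD : (F a <= F x <= F b)%R by rewrite !F_mono ?lexx ?ltW// !ltW.
  rewrite (_ : (fun y => _) = (cst (h (F x))) \_ `[0, f x]); last first.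
    apply/funext => y; rewrite /patch/=.
    have -> : ((x, y) \in G @^-1` D) = (y \in `[0, f x]%classic).
      rewrite /G; apply/idP/idP; rewrite !inE/= in_itv/= axb/=.
        rewrite DE; case: ifPn => // _ /andP[_].
        by rewrite gerDl ler10.
      by move=> ->; rewrite DE.
    case: ifPn => //; rewrite inE/= in_itv/= => yf.
    by rewrite /G /= axb yf.
  rewrite -integral_mkcond integral_cst//=; congr (_ * _)%E.
  rewrite lebesgue_measure_itv/= lte_fin oppr0 adde0.
  by rewrite f_gt0 // in_itv/= axb.
- apply: integral0_eq => y _; rewrite /patch; case: ifPn => //.
  rewrite inE /G /= DE; case: ifPn => [/andP[xab']|_].
    by case/negP: xab; apply/mem_set; rewrite /= in_itv/=.
  by move=> /andP[_]; rewrite gerDl ler10.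
Qed.

(** Since [h] is only measurable, the two sides are compared as measures on [D]. Lebesgue measure
    and [m1] agree on the traces of the rays [[y, +oo[] by the fundamental theorem of calculus, and
    these rays generate the Borel sets. *)
Lemma ge0_integral_substitution (h : R -> \bar R) : measurable_fun setT h ->
  (forall y, 0 <= h y)%E ->
  (\int[mu]_(y in `[F a, F b]) h y =
   \int[mu]_(x in `[a, b]) (h (F x) * (f x)%:E))%E.
Proof.
move=> mh h0; rewrite -integral_m1// -/D.
have mD : measurable D by exact: measurable_itv.
pose pf : {measure set GR -> \bar R} := pushforward (mu \x mu)%E G.
pose m2 : {measure set GR -> \bar R} := pf mG.
pose n1 : {measure set GR -> \bar R} := mrestr mu mD.
pose n2 : {measure set GR -> \bar R} := mrestr m2 mD.
suff m12 A : measurable A -> n1 A = n2 A.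
  apply: (eq_measure_integral m2) => A mA AD.
  by move: (m12 A mA); rewrite /n1 /n2 /= /mrestr !setIidl.
move=> mA.
apply: (@measure_unique _ R GR (@RGenCInfty.G R) (fun k : nat => `[- k%:R, +oo[%classic)) => //.
- exact: RGenCInfty.measurableE.
- move=> _ _ [x ->] [y ->]; exists (Num.max x y).
  by apply/seteqP; split => z /=; rewrite !in_itv/= !andbT ge_max => /andP.
- by move=> k; exists (- k%:R).
- apply/seteqP; split => // x _;
  exists (Num.truncn `|x|).+1 => //=; rewrite in_itv/= andbT lerNl.
  by rewrite (le_trans (ler_norm _))// normrN ltW// truncnS_gt.
- move=> _ [y ->]; have [yFb|Fby] := leP y (F b); last first.
    rewrite /n1 /n2 /= /mrestr (_ : _ `&` _ = set0) ?measure0//.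
    apply/seteqP; split => // z [/=]; rewrite /D/= !in_itv/= andbT => yz /andP[_ zb].
    by move: (lt_le_trans Fby (le_trans yz zb)); rewrite ltxx.
  have Fab : F a <= F b by rewrite F_mono ?lexx ?ltW.
  (* The maximum is a value of [F] even for a ray that starts to the left of [D]; in both cases the
     ray meets [D] in [[F c, F b]]. *)
  have [||c] := @IVT R F a b (Num.max y (F a)) (ltW ab).
  + exact: continuous_subspaceT.
  + by rewrite (min_idPl Fab) (max_idPr Fab) le_max lexx orbT ge_max yFb Fab.
  rewrite in_itv/= => cab Fc; have /andP[ac cb] := cab.
  have ID : `[y, +oo[ `&` D = [set` `[F c, F b]].
    apply/seteqP; split => z /=; rewrite /D /= !in_itv/= Fc ge_max andbT.
      by move=> [-> /andP[-> ->]].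
    by move=> /andP[/andP[-> ->] ->].
  rewrite /n1 /n2 /= /mrestr ID; set I := [set` `[F c, F b]].
  change (mu I = m2 I).
  have mI : @measurable _ GR I by exact: measurable_itv.
  have -> : m2 I = (\int[m2]_(z in D) (\1_I z)%:E)%E.
    rewrite integral_indic//; congr (m2 _).
    apply/seteqP; split => z; last by case.
    rewrite /I /D /= !in_itv/= => /andP[cz zb]; split; first by rewrite cz.
    by rewrite zb (le_trans _ cz)// Fc le_max lexx orbT.
  rewrite (integral_m1 (h := fun z => (\1_I z)%:E)); last 2 first.
  + by apply/measurable_EFinP; apply: measurable_indic.
  + by move=> z; rewrite lee_fin.
  rewrite (_ : (\int[mu]_(x in `[a, b]) _ = \int[mu]_(x in `[c, b]) (f x)%:E)%E); last first.
    rewrite [LHS]integral_mkcond [RHS]integral_mkcond; apply: eq_integral => x _.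
    rewrite !patchE; case: ifPn => xab; last first.
      rewrite ifN //; apply: contra xab; rewrite !inE/= !in_itv/= => /andP[cx ->].
      by rewrite (le_trans ac cx).
    move: xab; rewrite inE/= in_itv/= => xab.
    have bab : a <= b <= b by rewrite (ltW ab) lexx.
    rewrite indicE !mem_setE !in_itv/= !F_mono//.
    by case: ifPn => _; rewrite ?mul1e ?mul0e.
  move: cb; rewrite le_eqVlt => /predU1P[cbE|cb].
    by rewrite /I cbE !set_itv1 lebesgue_measure_set1 integral_set1.
  rewrite (@continuous_FTC2 R f F c b)//; last 3 first.
  + exact: continuous_subspaceT.
  + split.
    * by move=> x _; have [] := dF x.
    * by apply: cvg_at_right_filter; exact: cF.
    * by apply: cvg_at_left_filter; exact: cF.
  + by move=> x _; rewrite derive1E; have [_ ->] := dF x.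
  by rewrite /I lebesgue_measure_itv/= lte_fin F_smono ?cb// ?lexx ?(ltW ab).
- move=> k; rewrite /n1 /= /mrestr.
  apply: (@le_lt_trans _ _ (mu D)); first by apply: le_measure; rewrite ?inE//=; apply: measurableI.
  by rewrite lebesgue_measure_itv/=; case: ifPn; rewrite ?ltry.
Qed.
End substitution.

(** * Invariance under the reflection of an interval *)

Section reflection.
Variable R : realType.
Notation mu := (@lebesgue_measure R).
Notation GR := (measurableTypeR R).

Lemma ge0_integral_reflect (c : R) (h : R -> \bar R) : measurable_fun setT h ->
  (forall y, 0 <= h y)%E ->
  (\int[mu]_(x in `[0%R, c]) h x = \int[mu]_(x in `[0%R, c]) h (c - x)%R)%E.
Proof.
move=> mh h0; pose G : GR -> GR := fun x => c - x.
have mG : measurable_fun [set: GR] G.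
  have mG' : measurable_fun [set: R] (fun x : R => c - x).
    by apply: measurable_funB.
  exact: mG'.
pose pf : {measure set GR -> \bar R} := pushforward mu G.
have muE A : measurable A -> mu A = pf mG A.
  move=> mA; apply: lebesgue_measure_unique => // _ [[a b]] _ <-.
  rewrite /pf /= /pushforward (_ : G @^-1` _ = `[c - b, c - a[%classic).
    rewrite !lebesgue_measure_itv/= !lte_fin ltrD2l ltrN2.
    by case: ifPn => // _; rewrite -!EFinB; congr (_%:E); lra.
  apply/seteqP; split => x /=; rewrite /G !in_itv/= => /andP[? ?]; apply/andP; split; lra.
have mD : @measurable _ GR `[0, c] by exact: measurable_itv.
transitivity (\int[pf mG]_(x in `[0%R, c]) h x)%E.
  by apply: eq_measure_integral => A mA _; exact: muE.
rewrite ge0_integral_pushforward//; last exact: measurable_funTS.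
congr (integral _ _ _).
by apply/seteqP; split => x /=; rewrite /G !in_itv/= => /andP[? ?]; apply/andP; split; lra.
Qed.

End reflection.

(** * Circle means as symmetric integral operators *)

Section circle_mean.
Variable R : realType.
Notation mu := (@lebesgue_measure R).
Notation GR := (measurableTypeR R).
Implicit Types (t x y phi : R) (h : R -> \bar R).

Definition circle_mean t h x : \bar R :=
  (\int[mu]_(phi in `[0%R, pi]) h (trans_arg t x phi))%E.

(** The Gram determinant of three unit vectors with inner products [x], [y] and [cos t]: it is
    positive when a point of height [x] and one of height [y] span, with the pole, a nondegenerate
    spherical triangle of side [t]. *)
Definition circle_disc t x y : R :=
  1 - x ^+ 2 - y ^+ 2 - cos t ^+ 2 + 2 * x * y * cos t.

(** The density in [y] of the heights on the circle, cut off outside the interval of heights that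
    the circle reaches. *)
Definition circle_kernel t x y : R :=
  if 0 < circle_disc t x y then circle_disc t x y `^ (- 2^-1) else 0.

Lemma circle_kernelC t x y : circle_kernel t x y = circle_kernel t y x.
Proof.
suff e : circle_disc t x y = circle_disc t y x by rewrite /circle_kernel e.
by rewrite /circle_disc; ring.
Qed.

Lemma circle_kernel_ge0 t x y : 0 <= circle_kernel t x y.
Proof. by rewrite /circle_kernel; case: ifPn => // _; exact: powR_ge0. Qed.

Lemma circle_discE t x y :
  circle_disc t x y = (1 - x ^+ 2) * sin t ^+ 2 - (x * cos t - y) ^+ 2.
Proof. by rewrite sin2cos2 /circle_disc; ring. Qed.

Lemma circle_disc_gt0 t x y : 0 < circle_disc t x y -> -1 < x < 1.
Proof.
rewrite circle_discE => H.
have : 0 < (1 - x ^+ 2) * sin t ^+ 2 by have := sqr_ge0 (x * cos t - y); lra.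
rewrite pmulr_lgt0; first by move=> ?; apply/andP; split; nra.
rewrite lt_neqAle sqr_ge0 andbT eq_sym; apply/negP => /eqP s0; move: H.
by rewrite s0 mulr0 sub0r oppr_gt0 ltNge sqr_ge0.
Qed.

Lemma circle_disc_trans_arg t x phi : -1 < x < 1 ->
  circle_disc t x (trans_arg t x phi) = (1 - x ^+ 2) * sin t ^+ 2 * sin phi ^+ 2.
Proof.
move=> /andP[x1 x2]; rewrite circle_discE /trans_arg.
have : Num.sqrt (1 - x ^+ 2) ^+ 2 = 1 - x ^+ 2 by rewrite sqr_sqrtr; nra.
by set s := Num.sqrt _ => e; rewrite (sin2cos2 phi) -e; ring.
Qed.

Lemma trans_argNt t x phi : trans_arg (- t) x phi = trans_arg t x (pi - phi).
Proof.
by rewrite /trans_arg cosN sinN cosB cospi sinpi; ring.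
Qed.

Lemma continuous_trans_arg t x : continuous (trans_arg t x).
Proof.
move=> phi; rewrite /trans_arg; apply: cvgB; first exact: cvg_cst.
by apply: cvgM; [exact: cvg_cst|exact: continuous_cos].
Qed.

Lemma measurable_trans_arg t x : measurable_fun setT (trans_arg t x).
Proof. by apply: continuous_measurable_fun; exact: continuous_trans_arg. Qed.

Lemma circle_meanN t h x : measurable_fun setT h -> (forall y, 0 <= h y)%E ->
  circle_mean (- t) h x = circle_mean t h x.
Proof.
move=> mh h0; rewrite /circle_mean [RHS]ge0_integral_reflect//; last first.
  by apply: measurableT_comp => //; exact: measurable_trans_arg.
by apply: eq_integral => phi _; rewrite trans_argNt.
Qed.

Lemma measurable_circle_kernel2 t :
  measurable_fun setT (fun z : R * R => circle_kernel t z.1 z.2).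
Proof.
have md : measurable_fun setT (fun z : R * R => circle_disc t z.1 z.2).
  rewrite /circle_disc; apply: measurable_funD; last first.
    by do 2![apply: measurable_funM => //]; apply: measurable_funM.
  apply: measurable_funB => //; apply: measurable_funB; [apply: measurable_funB => //|];
    exact: measurable_funX.
apply: measurable_fun_ifT => //=.
  exact: measurable_fun_ltr.
by apply: (measurableT_comp (f := fun r : R => r `^ (- 2^-1))).
Qed.

Lemma measurable_circle_kernel t x : measurable_fun setT (circle_kernel t x).
Proof.
have mx : measurable_fun [set: R] (pair x : R -> R * R) by exact: pair1_measurable.
exact: (measurableT_comp (measurable_circle_kernel2 t) mx).
Qed.

(** For [sin t > 0] the height [y = trans_arg t x phi] increases with [phi],
    [dy = A * sin phi dphi], and [circle_disc] at [y] equals [(A * sin phi) ^ 2], so the Jacobian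
    cancels the kernel. Evenness in [t] covers the other sign. *)
Lemma circle_meanE t h x : -1 < x < 1 -> sin t != 0 -> measurable_fun setT h ->
  (forall y, 0 <= h y)%E ->
  circle_mean t h x = (\int[mu]_y (h y * (circle_kernel t x y)%:E))%E.
Proof.
move=> x11 + mh h0; wlog st : t / 0 < sin t => [wh|_].
  move=> st0; have [|] := ltP 0 (sin t); first by move=> ?; exact: wh.
  move=> st; have st' : sin t < 0 by rewrite lt_neqAle st0.
  rewrite -(circle_meanN t x mh h0).
  have -> := wh (- t); last 2 first.
  - by rewrite sinN oppr_gt0.
  - by rewrite sinN oppr_eq0.
  apply: eq_integral => y _; congr (_ * _%:E)%E.
  by rewrite /circle_kernel /circle_disc cosN.
have /andP[x1 x2] := x11.
pose A := Num.sqrt (1 - x ^+ 2) * sin t.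
have A0 : 0 < A by rewrite mulr_gt0// sqrtr_gt0; nra.
pose g y : \bar R := (h y * (circle_kernel t x y)%:E)%E.
have mg : measurable_fun setT g.
  apply: emeasurable_funM => //; apply/measurable_EFinP.
  exact: measurable_circle_kernel.
have g0 y : (0 <= g y)%E by rewrite mule_ge0// lee_fin circle_kernel_ge0.
have A2 : A ^+ 2 = (1 - x ^+ 2) * sin t ^+ 2.
  by rewrite /A exprMn sqr_sqrtr//; nra.
have F0 : trans_arg t x 0 = x * cos t - A by rewrite /trans_arg cos0 mulr1.
have Fpi : trans_arg t x pi = x * cos t + A by rewrite /trans_arg cospi mulrN1 opprK.
transitivity (\int[mu]_(y in `[trans_arg t x 0, trans_arg t x pi]) g y)%E; last first.
  rewrite integral_mkcond; apply: eq_integral => y _; rewrite patchE; case: ifPn => //.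
  rewrite F0 Fpi notin_setE/= in_itv/= => /negP yA.
  rewrite /g /circle_kernel ifN ?mule0// -leNgt circle_discE -A2 subr_le0.
  rewrite -ler_sqrt ?sqr_ge0// !sqrtr_sqr (ger0_norm (ltW A0)).
  move: yA; rewrite negb_and -!ltNge => /orP[yA|yA].
    by rewrite ger0_norm; lra.
  by rewrite ler0_norm; lra.
have dF phi : is_derive (phi : R) (1 : R) (trans_arg t x) (A * sin phi).
  rewrite (_ : trans_arg t x = cst (x * cos t) - A *: (@cos R)); last first.
    by apply/funext => u; rewrite /trans_arg -/A.
  by apply: is_derive_eq; rewrite sub0r scalerN opprK.
rewrite (@ge0_integral_substitution R (trans_arg t x) (fun phi => A * sin phi) 0 pi (pi_gt0 R) dF)//; last 2 first.
- by move=> phi; apply: cvgM; [exact: cvg_cst|exact: continuous_sin].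
- by move=> phi; rewrite in_itv/= => phi0; rewrite mulr_gt0// sin_gt0_pi.
have mcomp (k : R -> \bar R) : measurable_fun setT k ->
    measurable_fun setT (fun phi => k (trans_arg t x phi)).
  by move=> mk; apply: measurableT_comp => //; exact: measurable_trans_arg.
(* The endpoints are removed because [sin] vanishes there and the kernel is cut off to 0, so the two
   integrands may differ. *)
rewrite /circle_mean [LHS]integral_itv_bndoo; last by apply: measurable_funTS; exact: mcomp.
rewrite [RHS]integral_itv_bndoo; last first.
  apply: measurable_funTS; apply: emeasurable_funM; first exact: mcomp.
  apply/measurable_EFinP; apply: measurable_funM => //.
  by apply: continuous_measurable_fun; exact: continuous_sin.
apply: eq_integral => phi; rewrite inE/= in_itv/= => phi0.
have sp : 0 < sin phi by exact: sin_gt0_pi.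
rewrite /g /circle_kernel circle_disc_trans_arg// -A2 -exprMn.
have Asp : 0 < (A * sin phi) ^+ 2 by rewrite exprn_gt0// mulr_gt0.
rewrite Asp powRN powR12_sqrt ?sqr_ge0// sqrtr_sqr.
have As0 : 0 < A * sin phi by rewrite mulr_gt0.
by rewrite gtr0_norm// -muleA -EFinM mulVf ?mule1// gt_eqF.
Qed.

Let D : set R := `]-1, 1[.

(** Restricting the second variable to [D] changes nothing, since the kernel vanishes for [y]
    outside [D]; the first is restricted because the mean has its kernel form only for [x] in
    [D]. *)
Let J t (F h : R -> \bar R) (z : GR * GR) : \bar R :=
  ((F \_ D) z.1 * ((h \_ D) z.2 * (circle_kernel t z.1 z.2)%:E))%E.

Let mJ t F h : measurable_fun setT F -> measurable_fun setT h ->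
  measurable_fun [set: GR * GR] (J t F h).
Proof.
move=> mF mh.
have mFh (k : R -> \bar R) : measurable_fun setT k -> measurable_fun setT (k \_ D).
  by move=> mk; apply/(measurable_restrictT _ (measurable_itv _)); exact: measurable_funTS.
suff : measurable_fun [set: R * R] (J t F h : R * R -> \bar R) by [].
apply: emeasurable_funM; first by apply: measurableT_comp; [exact: mFh|].
apply: emeasurable_funM; first by apply: measurableT_comp; [exact: mFh|].
by apply/measurable_EFinP; exact: measurable_circle_kernel2.
Qed.

Let circle_mean_restr t h x : sin t != 0 -> -1 < x < 1 -> measurable_fun setT h ->
    (forall y, 0 <= h y)%E ->
  circle_mean t h x = (\int[mu]_y ((h \_ D) y * (circle_kernel t x y)%:E))%E.
Proof.
move=> st x11 mh h0; rewrite circle_meanE//; apply: eq_integral => y _.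
rewrite patchE; case: ifPn => //; rewrite notin_setE /D/= in_itv/= => yD.
rewrite circle_kernelC /circle_kernel; case: ifPn => [/circle_disc_gt0//|_].
by rewrite !mule0.
Qed.

Let restrD_ge0 (k : R -> \bar R) : (forall y, 0 <= k y)%E ->
  forall y, (0 <= (k \_ D) y)%E.
Proof. by move=> k0 y; exact: erestrict_ge0. Qed.

Let J_ge0 t F h : (forall y, 0 <= F y)%E -> (forall y, 0 <= h y)%E ->
  forall z, (0 <= J t F h z)%E.
Proof.
move=> F0 h0 z; rewrite !mule_ge0 ?restrD_ge0//.
by rewrite lee_fin circle_kernel_ge0.
Qed.

Let J_fst t F h x : sin t != 0 -> measurable_fun setT h ->
    (forall y, 0 <= F y)%E -> (forall y, 0 <= h y)%E ->
  (\int[mu]_y J t F h (x, y))%E = ((F \_ D) x * (circle_mean t h \_ D) x)%E.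
Proof.
move=> st mh F0 h0; rewrite /J/= ge0_integralZl//=; last 3 first.
- apply: emeasurable_funM.
    by apply/(measurable_restrictT _ (measurable_itv _)); exact: measurable_funTS.
  by apply/measurable_EFinP; exact: measurable_circle_kernel.
- by move=> y _; rewrite mule_ge0 ?restrD_ge0// lee_fin circle_kernel_ge0.
- exact: restrD_ge0.
rewrite !patchE; case: ifPn => xD; last by rewrite !mul0e.
by rewrite circle_mean_restr//; move: xD; rewrite inE /D/= in_itv.
Qed.

Lemma circle_mean_ge0 t h x : (forall y, 0 <= h y)%E -> (0 <= circle_mean t h x)%E.
Proof. by move=> h0; exact: integral_ge0. Qed.

Lemma measurable_circle_mean t h : sin t != 0 -> measurable_fun setT h ->
  (forall y, 0 <= h y)%E -> measurable_fun setT (circle_mean t h \_ D).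
Proof.
move=> st mh h0.
have := @measurable_fun_fubini_tonelli_F _ _ GR GR R mu (J t (cst 1%E) h).
have J1 z : (0 <= J t (cst 1%E) h z)%E by apply: J_ge0 => // y; exact: lee01.
move=> /(_ (mJ t (measurable_cst _) mh)) /(_ J1).
congr (measurable_fun _ _); apply/funext => x.
rewrite /fubini_F J_fst// !patchE; case: ifPn => _; by rewrite ?mul1e ?mul0e.
Qed.

(* Substituting [y = trans_arg t x phi] turns [circle_mean t] into an integral
   operator whose kernel is symmetric in [x] and [y]. *)
Lemma circle_mean_selfadjoint t F h : sin t != 0 ->
  measurable_fun setT F -> measurable_fun setT h ->
  (forall y, 0 <= F y)%E -> (forall y, 0 <= h y)%E ->
  (\int[mu]_(x in D) (F x * circle_mean t h x) =
   \int[mu]_(y in D) (h y * circle_mean t F y))%E.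
Proof.
move=> st mF mh F0 h0.
have E (F' h' : R -> \bar R) : measurable_fun setT h' ->
    (forall y, 0 <= F' y)%E -> (forall y, 0 <= h' y)%E ->
  (\int[mu]_(x in D) (F' x * circle_mean t h' x) = \int[mu]_x \int[mu]_y J t F' h' (x, y))%E.
  move=> mh' F'0 h'0; rewrite integral_mkcond; apply: eq_integral => x _.
  by rewrite J_fst// !patchE; case: ifPn => // _; rewrite mul0e.
rewrite (E F h mh F0 h0) (E h F mF h0 F0).
have := @fubini_tonelli _ _ GR GR R mu mu (J t F h) (mJ t mF mh) (J_ge0 t F0 h0).
move=> ->; apply: eq_integral => y _; apply: eq_integral => x _.
by rewrite /J/= circle_kernelC muleCA.
Qed.

(** The heights on the circle have a density, so a null set is invisible to the mean at every
    [x]. *)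
Lemma circle_mean_null t (N : set R) x : sin t != 0 -> -1 < x < 1 ->
  measurable N -> mu N = 0 -> circle_mean t (fun y => (\1_N y)%:E) x = 0%E.
Proof.
move=> st x11 mN N0; rewrite circle_meanE//; last by apply/measurable_EFinP; exact: measurable_indic.
rewrite (ge0_negligible_integral (N := N : set GR))//=; last 2 first.
- apply: emeasurable_funM; apply/measurable_EFinP; first exact: measurable_indic.
  exact: measurable_circle_kernel.
- by move=> y _; rewrite mule_ge0// lee_fin// circle_kernel_ge0.
by apply: integral0_eq => y [_ yN]; rewrite indicE memNset// mul0e.
Qed.

End circle_mean.

(** * Borel and Lebesgue measurability *)

Section completed.
Variable R : realType.
Notation mu := (@lebesgue_measure R).
Notation cmu := (@completed_lebesgue_measure R).
Notation GR := (measurableTypeR R).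
Notation LR := (lebesgueType R).
Implicit Types (A D N : set R).

Lemma borel_lebesgue_measurable A : @measurable _ GR A -> @measurable _ LR A.
Proof. exact: sub_caratheodory. Qed.

Lemma measurable_fun_completed d (T : measurableType d) D (f : R -> T) :
  @measurable _ GR D ->
  @measurable_fun _ _ GR T D f -> @measurable_fun _ _ LR T D f.
Proof.
move=> mD mf _ Y mY; apply: borel_lebesgue_measurable; exact: mf.
Qed.

Lemma integral_completed D (f : R -> \bar R) : @measurable _ GR D ->
  @measurable_fun _ _ GR _ D f ->
  (\int[cmu]_(x in (D : set LR)) f x = \int[mu]_(x in D) f x)%E.
Proof.
move=> mD mf.
pose G : LR -> GR := id.
have mG : measurable_fun [set: LR] G.
  by move=> _ Y mY; rewrite setTI; exact: borel_lebesgue_measurable.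
have H (h : R -> \bar R) : @measurable_fun _ _ GR _ D h -> (forall x, 0 <= h x)%E ->
    (\int[cmu]_(x in (D : set LR)) h x = \int[mu]_(x in D) h x)%E.
  move=> mh h0.
  rewrite -(ge0_integral_pushforward mG cmu (D := D) (f := h))//.
rewrite integralE [RHS]integralE !H//.
- exact: measurable_funeneg.
- exact: measurable_funepos.
Qed.

Lemma completed_measurable_null A : @measurable _ LR A ->
  exists N, [/\ @measurable _ GR N, mu N = 0%E & @measurable _ GR (A `\` N)].
Proof.
move=> mA.
have : (completed_algebra_gen mu).-sigma.-measurable A.
  by rewrite completed_caratheodory_measurable.
rewrite g_sigma_completed_algebra_genE => -[/= B mB [M [N [mN N0 MN]] <-]].
exists N; split => //.
rewrite (_ : _ `\` _ = B `\` N); first exact: measurableD.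
apply/seteqP; split => x /= [].
  by move=> [Bx|/MN Nx].
by move=> Bx Nx; split => //; left.
Qed.

(** Each superlevel set at a rational level is Borel off a null set. The countable union of these
    null sets works for all levels at once, because a superlevel set is the union of those at larger
    rational levels. *)
Lemma completed_measurable_fun_null D (f : R -> R) :
  @measurable _ GR D -> @measurable_fun _ _ LR _ D f ->
  exists N, [/\ @measurable _ GR N, mu N = 0%E &
    @measurable_fun _ _ GR _ (D `\` N) f].
Proof.
move=> mD mf.
have E (q : rat) : exists N, [/\ @measurable _ GR N, mu N = 0%E &
    @measurable _ GR ((D `&` f @^-1` `]ratr q, +oo[) `\` N)].
  apply: completed_measurable_null; apply: mf => //.
  exact: borel_lebesgue_measurable.
have [N_ N_P] := choice E.
(* An enumeration of the rationals; codes of no rational repeat the level 0. *)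
pose q_ (n : nat) : rat := odflt 0 (unpickle n).
pose N := \bigcup_n N_ (q_ n).
have mN_ q : @measurable _ GR (N_ q) by have [] := N_P q.
have mN : @measurable _ GR N by exact: bigcupT_measurable.
exists N; split => //.
  apply: measure_negligible => //; apply: negligible_bigcup => n.
  by exists (N_ (q_ n)); split => //; have [] := N_P (q_ n).
have mDN : @measurable _ GR (D `\` N) by exact: measurableD.
apply: (measurability _ (RGenOInfty.measurableE R)) => _ [_ [r ->] <-].
rewrite (_ : _ `&` _ = \bigcup_n (if r < ratr (q_ n) then
  (D `&` f @^-1` `]ratr (q_ n), +oo[ `\` N_ (q_ n)) `\` N else set0)).
  apply: bigcupT_measurable => n; case: ifPn => // _.
  by apply: measurableD => //; have [] := N_P (q_ n).
apply/seteqP; split => x.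
  move=> [[Dx Nx]] /=; rewrite in_itv/= andbT => /rat_in_itvoo[q].
  rewrite in_itv/= => /andP[rq qfx].
  have qE : q_ (pickle q) = q by rewrite /q_ pickleK.
  exists (pickle q) => //; rewrite qE rq; split => //; split.
    by split => //=; rewrite in_itv/= andbT.
  by move=> Nqx; apply: Nx; exists (pickle q) => //; rewrite qE.
move=> [n _]; case: ifPn => // rq [[[Dx]]]/=; rewrite !in_itv/= !andbT => qf _ Nx.
by split => //; rewrite /preimage/= ?in_itv/= ?andbT (lt_trans rq).
Qed.

End completed.

(** * Norms of extended-real functions: order, scaling, Minkowski *)

Section Lnorm_extra.
Local Open Scope ereal_scope.
Context d (T : measurableType d) (R : realType).
Variable mu : {measure set T -> \bar R}.
Implicit Types (f g : T -> \bar R) (p : \bar R).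

(* Unlike [ge0_le_integral], no measurability is needed: the integral of a
   nonnegative function is a supremum over simple functions below it. *)
Lemma ge0_le_integral_nonmeasurable f g : (forall x, 0 <= f x) ->
  (forall x, f x <= g x) -> \int[mu]_x f x <= \int[mu]_x g x.
Proof.
move=> f0 fg; rewrite !ge0_integralTE//; last by move=> x; exact: le_trans (fg x).
by apply: ereal_sup_le => _ [h /= hf <-]; exists h => //= x; exact: le_trans (fg x).
Qed.

Lemma le_Lnorm p f g : 1 <= p -> (forall x, `|f x| <= `|g x|) ->
  Lnorm mu p f <= Lnorm mu p g.
Proof.
move=> p1 fg; rewrite unlock /Lnorm; case: p p1 => [r|_|//].
  rewrite lee_fin => r1.
  apply: gt0_ler_poweR; rewrite ?invr_ge0 ?(le_trans ler01)//.
  - by rewrite in_itv/= leey andbT integral_ge0// => x _; exact: poweR_ge0.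
  - by rewrite in_itv/= leey andbT integral_ge0// => x _; exact: poweR_ge0.
  apply: ge0_le_integral_nonmeasurable => x; first exact: poweR_ge0.
  apply: gt0_ler_poweR; rewrite ?(le_trans ler01)// in_itv/= ?leey ?andbT//.
by case: ifPn => // _; apply: le_ess_sup; exact: nearW.
Qed.

Lemma ae_eq_Lnorm p f g : 1 <= p -> measurable_fun setT f ->
  measurable_fun setT g -> {ae mu, forall x, f x = g x} ->
  Lnorm mu p f = Lnorm mu p g.
Proof.
move=> p1 mf mg fg; rewrite unlock /Lnorm; case: p p1 => [r|_|//].
  move=> r1; congr (_ `^ _); apply: ge0_ae_eq_integral => //.
  - by apply: (measurableT_comp (measurable_poweR r)); exact: measurableT_comp.
  - by apply: (measurableT_comp (measurable_poweR r)); exact: measurableT_comp.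
  - by move=> x _; exact: poweR_ge0.
  - by move=> x _; exact: poweR_ge0.
  - by apply: filterS fg => x -> _.
by case: ifPn => // _; apply: eq_ess_sup; apply: filterS fg => x /= ->.
Qed.

Lemma LnormZ_ge0 p f (k : R) : 1 <= p -> (0 <= k)%R -> measurable_fun setT f ->
  Lnorm mu p (fun x => k%:E * f x) = k%:E * Lnorm mu p f.
Proof.
move=> p1 k0 mf; rewrite unlock /Lnorm; case: p p1 => [r|_|//].
  rewrite lee_fin => r1; have r0 : (0 < r)%R by apply: lt_le_trans r1.
  have E x : `|k%:E * f x| `^ r = (k `^ r)%:E * `|f x| `^ r.
    by rewrite abseM poweRM// /= ger0_norm// poweR_EFin.
  under eq_integral do rewrite E.
  rewrite ge0_integralZl_EFin//; last 3 first.
  - by move=> x _; exact: poweR_ge0.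
  - by apply: (measurableT_comp (measurable_poweR r)); exact: measurableT_comp.
  - exact: powR_ge0.
  rewrite poweRM ?lee_fin ?powR_ge0//; last first.
    by apply: integral_ge0 => x _; exact: poweR_ge0.
  by rewrite poweR_EFin -powRrM mulfV ?gt_eqF// powRr1.
case: ifPn => [m0|_]; last by rewrite mule0.
rewrite -ess_supZl//; congr ess_sup; apply/funext => x /=.
by rewrite abseM /= ger0_norm.
Qed.

(** For finite [p] an infinite norm on the right leaves nothing to prove. Otherwise both functions
    are finite almost everywhere and may be replaced by real-valued ones, for which Minkowski's
    inequality is available. *)
Lemma Lnorm_ge0D p f g : 1 <= p -> measurable_fun setT f ->
  measurable_fun setT g -> (forall x, 0 <= f x) -> (forall x, 0 <= g x) ->
  Lnorm mu p (fun x => f x + g x) <= Lnorm mu p f + Lnorm mu p g.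
Proof.
move=> p1 mf mg f0 g0; case: p p1 => [r|_|//]; last first.
  rewrite unlock /Lnorm; case: ifPn => _; last by rewrite adde0.
  exact: ess_sup_absD.
move=> r1; have r1' : (1 <= r)%R by rewrite -lee_fin.
have r0 : (0 < r)%R by apply: lt_le_trans r1'.
have fin (h : T -> \bar R) : measurable_fun setT h -> (forall x, 0 <= h x) ->
    Lnorm mu r%:E h < +oo -> {ae mu, forall x, h x = (fine (h x))%:E}.
  move=> mh h0; rewrite unlock /Lnorm => /lty_poweRy; rewrite invr_eq0 gt_eqF// => /(_ isT) hoo.
  have /integrable_ae : mu.-integrable setT (fun x => `|h x| `^ r).
    apply/integrableP; split.
      by apply: (measurableT_comp (measurable_poweR r)); exact: measurableT_comp.
    by under eq_integral do rewrite gee0_abs ?poweR_ge0//.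
  move=> /(_ measurableT); apply: filterS => x /(_ I) hx; rewrite fineK//.
  rewrite ge0_fin_numE//; move: hx; rewrite ge0_fin_numE ?poweR_ge0//.
  by move=> /lty_poweRy; rewrite gt_eqF// gee0_abs// => ->.
have [foo|] := eqVneq (Lnorm mu r%:E f) +oo.
  by rewrite foo addye ?leey// gt_eqF// (lt_le_trans _ (Lnorm_ge0 _ _ _)).
have [goo|] := eqVneq (Lnorm mu r%:E g) +oo.
  by rewrite goo addey ?leey// gt_eqF// (lt_le_trans _ (Lnorm_ge0 _ _ _)).
rewrite -!ltey => goo foo.
have aef := fin f mf f0 foo; have aeg := fin g mg g0 goo.
have mff : measurable_fun setT (fine \o f) by exact: measurableT_comp.
have mfg : measurable_fun setT (fine \o g) by exact: measurableT_comp.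
rewrite (@ae_eq_Lnorm _ f (EFin \o (fine \o f)))//; last by apply/measurable_EFinP.
rewrite (@ae_eq_Lnorm _ g (EFin \o (fine \o g)))//; last by apply/measurable_EFinP.
rewrite (@ae_eq_Lnorm _ (fun x => f x + g x) (EFin \o ((fine \o f) \+ (fine \o g))%R))//.
- exact: eminkowski.
- exact: emeasurable_funD.
- by apply/measurable_EFinP; exact: measurable_funD.
- by apply: filterS2 aef aeg => x {1}-> {1}->.
Qed.

End Lnorm_extra.

(** For [p = +oo], both measures have the same almost-everywhere upper bounds, because the sets
    where a Borel function exceeds a level are Borel. *)
Lemma Lnorm_completed (R : realType) p (f : R -> \bar R) :
  (1 <= p)%E -> measurable_fun setT f ->
  Lnorm (@completed_lebesgue_measure R) p f = Lnorm (@lebesgue_measure R) p f.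
Proof.
move=> p1 mf; have mfa : measurable_fun setT (fun x => `|f x|%E) by exact: measurableT_comp.
rewrite unlock /Lnorm; case: p p1 => [r|_|//].
  move=> r1; congr (_ `^ _)%E; rewrite integral_completed//.
  by apply: (measurableT_comp (measurable_poweR r)).
suff -> : ess_sup (@completed_lebesgue_measure R) (abse \o f) =
          ess_sup (@lebesgue_measure R) (abse \o f) by [].
rewrite !ess_supEae; congr ereal_inf.
have mfc := @measurable_fun_completed R _ _ setT _ measurableT mfa.
have mfl : @measurable_fun _ _ (measurableTypeR R) _ setT (fun x => `|f x|%E) by exact: mfa.
apply/seteqP; split => y /= H.
- apply: ((ae_le_measureP (@lebesgue_measure R) y mfl).2 _).
  exact: ((ae_le_measureP (@completed_lebesgue_measure R) y mfc).1 H).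
- apply: ((ae_le_measureP (@completed_lebesgue_measure R) y mfc).2 _).
  exact: ((ae_le_measureP (@lebesgue_measure R) y mfl).1 H).
Qed.

(** * Circle means of singular weights *)

Section angular_integral.
Variable R : realType.
Notation mu := (@lebesgue_measure R).
Implicit Types (x y phi : R).

(** By the mean value theorem [sin (x / 2) >= (x / 2) * cos (x / 2)]; hence [sin x >= x * cos (x /
    2) ^ 2 = x * (1 + cos x) / 2], and [cos x >= 0]. *)
Lemma sin_ge_half x : 0 <= x <= pi / 2 -> x / 2 <= sin x.
Proof.
move=> /andP[x0 xpi]; have := pi_gt0 R => pi0.
have y2 : x = x / 2 + x / 2 by lra.
have cy : 0 <= cos (x / 2) by apply: cos_ge0_pihalf; apply/andP; split; lra.
have siny : x / 2 * cos (x / 2) <= sin (x / 2).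
  have x20 : 0 <= x / 2 by lra.
  have [|c] := @MVT_segment R (@sin R) (@cos R) 0 (x / 2) x20 (fun z _ => is_derive_sin z).
    by apply: continuous_subspaceT; exact: continuous_sin.
  rewrite in_itv/= sin0 !subr0 => /andP[c0 cx] ->; rewrite mulrC ler_wpM2r//.
  by rewrite leNgt ltr_cos ?in_itv/= -?leNgt//; apply/andP; split; lra.
have cosx : 0 <= cos x by apply: cos_ge0_pihalf; apply/andP; split; lra.
rewrite [in leRHS]y2 sinD.
have := cosD (x / 2) (x / 2); rewrite -y2 => cosxE.
have := cos2Dsin2 (x / 2) => cs.
have : x / 2 * cos (x / 2) * cos (x / 2) <= sin (x / 2) * cos (x / 2).
  exact: ler_wpM2r.
nra.
Qed.

Lemma powRN_antitone (s x y : R) : 0 <= s -> 0 < x -> x <= y ->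
  y `^ (- s) <= x `^ (- s).
Proof.
move=> s0 x0 xy; rewrite !powRN lef_pV2 ?posrE ?powR_gt0 ?(lt_le_trans x0)//.
by rewrite ge0_ler_powR// nnegrE ltW// (lt_le_trans x0).
Qed.

Lemma measurable_powR_EFin (s : R) : measurable_fun [set: R] (fun y => (y `^ s)%:E).
Proof. by apply/measurable_EFinP; exact: measurable_powR. Qed.

Lemma integral_powRN_lty (s : R) : 0 <= s < 1 ->
  (\int[mu]_(y in `[0%R, pi]) (y `^ (- s))%:E < +oo)%E.
Proof.
move=> /andP[s0 s1].
have pi1 : 1 < pi :> R by have := @pihalf_ge1 R; lra.
(* Substituting [y = r ^ m] turns the integrand into [m * r ^ (m * (1 - s) - 1)], which is bounded
   once [m * (1 - s) >= 1]. Having [m >= 2] makes the factor [r ^ m.-1] vanish at [r = 0]. *)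
pose m := (Num.truncn (1 - s)^-1).+2.
have ms : 1 <= m%:R * (1 - s).
  rewrite -ler_pdivrMr ?subr_gt0// div1r (le_trans (ltW (truncnS_gt _)))//.
  by rewrite ler_nat.
pose b : R := pi ^+ m.
pose C : R := m%:R * pi `^ (m%:R * (1 - s) - 1).
apply: (@le_lt_trans _ _ (\int[mu]_(y in `[0%R, b]) (y `^ (- s))%:E)%E).
  apply: ge0_subset_integral => //.
  - by apply: measurable_funTS; exact: measurable_powR_EFin.
  - by move=> y _; rewrite lee_fin powR_ge0.
  - move=> y /=; rewrite !in_itv/= => /andP[-> ypi]; rewrite (le_trans ypi)//.
    by rewrite /b -{1}(expr1 pi) ler_eXn2l.
have dm (x : R) : is_derive x (1 : R) (fun r : R => r ^+ m) (m%:R * x ^+ m.-1).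
  by apply: DeriveDef; [exact: exprn_derivable|rewrite exp_derive; exact: mulr1].
have cm : continuous (fun r : R => m%:R * r ^+ m.-1).
  by move=> r; apply: cvgM; [exact: cvg_cst|exact: exprn_continuous].
have m0 (r : R) : r \in `]0, pi[ -> 0 < m%:R * r ^+ m.-1.
  by rewrite in_itv/= => /andP[r0 _]; rewrite mulr_gt0// exprn_gt0.
have h0 (y : R) : (0 <= (y `^ (- s))%:E)%E by rewrite lee_fin powR_ge0.
have := ge0_integral_substitution (pi_gt0 R) dm cm m0 (measurable_powR_EFin (- s)) h0.
have mg : measurable_fun [set: R]
    (fun r : R => ((r ^+ m) `^ (- s))%:E * (m%:R * r ^+ m.-1)%:E)%E.
  apply: emeasurable_funM; last by apply/measurable_EFinP; exact: measurable_funM.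
  have mX : measurable_fun [set: R] (fun r : R => r ^+ m) by [].
  exact: (measurableT_comp (measurable_powR_EFin (- s)) mX).
rewrite [(0 ^+ m)%R]expr0n -/b => ->.
apply: (@le_lt_trans _ _ (\int[mu]_(y in `[0%R, pi]) C%:E)%E); last first.
  rewrite integral_cst//= lebesgue_measure_itv/= lte_fin pi_gt0 oppr0 adde0.
  by rewrite -EFinM ltry.
apply: ge0_le_integral => //.
- move=> r /=; rewrite in_itv/= => /andP[r0 _].
  by rewrite -EFinM lee_fin mulr_ge0 ?powR_ge0// mulr_ge0// exprn_ge0.
- exact: measurable_funTS.
move=> r /=; rewrite in_itv/= => /andP[]; rewrite le_eqVlt => /predU1P[<- _|r0 rpi].
  by rewrite [(0 ^+ m.-1)%R]expr0n/= mulr0 mule0 lee_fin mulr_ge0// powR_ge0.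
rewrite -EFinM lee_fin /C mulrCA ler_wpM2l//.
have r0' := ltW r0; have pi0' := ltW (pi_gt0 R).
rewrite -powR_mulrn// -powRrM -[r ^+ m.-1]powR_mulrn// -powRD; last first.
  by rewrite (gt_eqF r0) implybT.
rewrite (_ : m%:R * - s + m.-1%:R = m%:R * (1 - s) - 1).
  by rewrite ge0_ler_powR// subr_ge0.
have -> : m%:R = m.-1%:R + 1 :> R by rewrite natr1.
by ring.
Qed.

(* The defect in [1 - y ^+ 2 >= (1 - x ^+ 2) * sin phi ^+ 2] is a square. *)
Lemma trans_arg_ge (t x phi : R) : -1 < x < 1 ->
  (1 - x ^+ 2) * sin phi ^+ 2 <= 1 - trans_arg t x phi ^+ 2.
Proof.
move=> x11; have : Num.sqrt (1 - x ^+ 2) ^+ 2 = 1 - x ^+ 2.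
  by move: x11 => /andP[? ?]; rewrite sqr_sqrtr//; nra.
rewrite /trans_arg; set u := Num.sqrt _ => u2; rewrite -subr_ge0.
have ct := cos2Dsin2 t; have cphi := cos2Dsin2 phi.
suff -> : 1 - (x * cos t - u * sin t * cos phi) ^+ 2 - (1 - x ^+ 2) * sin phi ^+ 2
   = (x * sin t + u * cos t * cos phi) ^+ 2 by exact: sqr_ge0.
apply/eqP; rewrite -subr_eq0; apply/eqP; rewrite -u2.
transitivity (1 - x ^+ 2 * (cos t ^+ 2 + sin t ^+ 2)
  - u ^+ 2 * cos phi ^+ 2 * (cos t ^+ 2 + sin t ^+ 2) - u ^+ 2 * sin phi ^+ 2); first by ring.
rewrite ct !mulr1.
transitivity (1 - x ^+ 2 - u ^+ 2 * (cos phi ^+ 2 + sin phi ^+ 2)); first by ring.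
by rewrite cphi u2; ring.
Qed.

Lemma trans_arg_itv (t x phi : R) : -1 < x < 1 -> 0 < phi < pi ->
  -1 < trans_arg t x phi < 1.
Proof.
move=> x11 phi0; have := trans_arg_ge t phi x11.
have : 0 < (1 - x ^+ 2) * sin phi ^+ 2.
  by move: x11 => /andP[? ?]; rewrite mulr_gt0 ?exprn_gt0 ?sin_gt0_pi//; nra.
by move=> H1 H2; apply/andP; split; nra.
Qed.

(** By [trans_arg_ge] the integrand is at most [(1 - x ^ 2) ^ (- e) * sin phi ^ (- 2 e)]; the second
    factor does not involve [t] or [x] and is integrable because [2 e < 1]. *)
Lemma circle_mean_weight (e : R) : 0 <= e < 2^-1 ->
  exists2 C : R, 0 < C & forall t x, -1 < x < 1 ->
    (circle_mean t (fun y => ((1 - y ^+ 2) `^ (- e))%:E) x <=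
     (C * (1 - x ^+ 2) `^ (- e))%:E)%E.
Proof.
move=> /andP[e0 e1]; pose s := 2 * e.
have s01 : 0 <= s < 1 by apply/andP; split; rewrite /s; lra.
have /andP[s0 s1] := s01.
pose I := (\int[mu]_(y in `[0%R, pi]) (y `^ (- s))%:E)%E.
have I0 : (0 <= I)%E by apply: integral_ge0 => y _; rewrite lee_fin powR_ge0.
have Ioo : (I < +oo)%E by exact: integral_powRN_lty.
pose C := 2 `^ s * (2 * fine I) + 1.
exists C; first by rewrite /C ltr_pwDr// mulr_ge0 ?powR_ge0// mulr_ge0// fine_ge0.
move=> t x x11; have /andP[x1 x2] := x11.
have q0 : 0 < 1 - x ^+ 2 by nra.
pose K := (1 - x ^+ 2) `^ (- e).
(* [sin phi] is at least half the distance from [phi] to the nearer endpoint; adding the powers for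
   both endpoints avoids splitting the integral. *)
pose B phi := ((K * 2 `^ s)%:E * ((phi `^ (- s))%:E + ((pi - phi) `^ (- s))%:E))%E.
have mp1 : measurable_fun [set: R] (fun phi : R => (phi `^ (- s))%:E).
  exact: measurable_powR_EFin.
have mp2 : measurable_fun [set: R] (fun phi : R => ((pi - phi) `^ (- s))%:E).
  have mB : measurable_fun [set: R] (fun phi : R => pi - phi) by exact: measurable_funB.
  exact: (measurableT_comp mp1 mB).
apply: (@le_trans _ _ (\int[mu]_(phi in `[0%R, pi]) B phi)%E); last first.
  rewrite ge0_integralZl_EFin//; last 3 first.
  - by move=> phi _; rewrite adde_ge0// lee_fin powR_ge0.
  - by apply: measurable_funTS; exact: emeasurable_funD.
  - by rewrite mulr_ge0 ?powR_ge0.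
  rewrite ge0_integralD//; last 4 first.
  - by move=> phi _; rewrite lee_fin powR_ge0.
  - exact: measurable_funTS.
  - by move=> phi _; rewrite lee_fin powR_ge0.
  - exact: measurable_funTS.
  rewrite -(@ge0_integral_reflect R pi (fun phi => (phi `^ (- s))%:E))//; last first.
    by move=> y; rewrite lee_fin powR_ge0.
  rewrite -/I -(@fineK _ I) ?ge0_fin_numE// -EFinD -EFinM lee_fin /C -/K.
  have K0 : 0 <= K by exact: powR_ge0.
  nra.
have mB : measurable_fun [set: R] B.
  by apply: emeasurable_funM => //; exact: emeasurable_funD.
have mw : measurable_fun [set: R] (fun phi => ((1 - trans_arg t x phi ^+ 2) `^ (- e))%:E).
  have my := measurable_trans_arg t x.
  have mq : measurable_fun [set: R] (fun phi => 1 - trans_arg t x phi ^+ 2).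
    by apply: measurable_funB => //; exact: measurable_funX.
  exact: (measurableT_comp (measurable_powR_EFin (- e)) mq).
rewrite /circle_mean integral_itv_bndoo; last exact: measurable_funTS.
rewrite [leRHS]integral_itv_bndoo; last exact: measurable_funTS.
apply: ge0_le_integral => //.
- by move=> phi _; rewrite lee_fin powR_ge0.
- exact: measurable_funTS.
- exact: measurable_funTS.
move=> phi /=; rewrite in_itv/= => phi0; have /andP[phi1 phi2] := phi0.
have sp : 0 < sin phi by exact: sin_gt0_pi.
rewrite /B -EFinD -EFinM lee_fin.
apply: (@le_trans _ _ (K * (sin phi) `^ (- s))).
  have -> : sin phi `^ (- s) = (sin phi ^+ 2) `^ (- e).
    by rewrite -powR_mulrn ?ltW// -powRrM /s mulrN.
  rewrite /K -powRM ?sqr_ge0 ?(ltW q0)//; apply: powRN_antitone => //.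
  - by rewrite mulr_gt0// exprn_gt0.
  - exact: trans_arg_ge.
rewrite -mulrA ler_wpM2l ?powR_ge0//.
have half (r : R) : 0 < r -> 2 `^ s * r `^ (- s) = (r / 2) `^ (- s).
  move=> r0; rewrite powRM ?invr_ge0 ?ltW// mulrC; congr (_ * _).
  by rewrite -powR_inv1// -powRrM mulN1r opprK.
rewrite mulrDr !half ?subr_gt0//.
have [h|h] := leP phi (pi / 2).
  rewrite (@le_trans _ _ ((phi / 2) `^ (- s)))// ?lerDl ?powR_ge0//.
  apply: powRN_antitone => //; first by rewrite divr_gt0.
  by rewrite sin_ge_half// h ltW.
rewrite (@le_trans _ _ (((pi - phi) / 2) `^ (- s)))// ?lerDr ?powR_ge0//.
have -> : sin phi = sin (pi - phi) by rewrite sinB sinpi cospi; ring.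
apply: powRN_antitone => //; first by rewrite divr_gt0// subr_gt0.
by rewrite sin_ge_half//; apply/andP; split; lra.
Qed.

End angular_integral.

(** * Order and Hoelder inequalities for circle means *)

Section circle_mean_order.
Variable R : realType.
Notation mu := (@lebesgue_measure R).
Implicit Types (t x y phi : R) (h : R -> \bar R).

Lemma le_circle_mean t h1 h2 x : -1 < x < 1 ->
  measurable_fun setT h1 -> measurable_fun setT h2 ->
  (forall y, 0 <= h1 y)%E -> (forall y, 0 <= h2 y)%E ->
  (forall y, -1 < y < 1 -> (h1 y <= h2 y)%E) ->
  (circle_mean t h1 x <= circle_mean t h2 x)%E.
Proof.
move=> x11 m1 m2 h10 h20 h12.
have mc h : measurable_fun setT h -> measurable_fun [set: R] (fun phi => h (trans_arg t x phi)).
  by move=> mh; exact: (measurableT_comp mh (measurable_trans_arg t x)).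
rewrite /circle_mean integral_itv_bndoo; last by apply: measurable_funTS; exact: mc.
rewrite [leRHS]integral_itv_bndoo; last by apply: measurable_funTS; exact: mc.
apply: ge0_le_integral => //.
- by apply: measurable_funTS; exact: mc.
- by apply: measurable_funTS; exact: mc.
by move=> phi /=; rewrite in_itv/= => phi0; apply: h12; exact: trans_arg_itv.
Qed.

Lemma eq_circle_mean t h1 h2 x : -1 < x < 1 ->
  measurable_fun setT h1 -> measurable_fun setT h2 ->
  (forall y, 0 <= h1 y)%E -> (forall y, 0 <= h2 y)%E ->
  (forall y, -1 < y < 1 -> h1 y = h2 y) ->
  circle_mean t h1 x = circle_mean t h2 x.
Proof.
move=> x11 m1 m2 h10 h20 h12; apply/eqP; rewrite eq_le.
by apply/andP; split; apply: le_circle_mean => // y y11; rewrite h12.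
Qed.

Lemma circle_meanZ t (k : R) h x : measurable_fun setT h -> (forall y, 0 <= h y)%E ->
  0 <= k -> circle_mean t (fun y => k%:E * h y)%E x = (k%:E * circle_mean t h x)%E.
Proof.
move=> mh h0 k0; rewrite /circle_mean ge0_integralZl_EFin//.
apply: measurable_funTS; exact: (measurableT_comp mh (measurable_trans_arg t x)).
Qed.

(** The measure of this set is the circle mean of the indicator of [N]. *)
Lemma trans_arg_null t x (N : set R) : sin t != 0 -> -1 < x < 1 ->
  measurable N -> mu N = 0%E ->
  mu.-negligible (`[0, pi] `&` trans_arg t x @^-1` N).
Proof.
move=> st x11 mN N0; have := circle_mean_null st x11 mN N0; rewrite /circle_mean.
have mNx : measurable (trans_arg t x @^-1` N).
  by rewrite -[_ @^-1` _]setTI; exact: measurable_trans_arg.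
under eq_integral do rewrite -[\1_N _]/(\1_(trans_arg t x @^-1` N) _).
rewrite integral_indic// => m0; exists (trans_arg t x @^-1` N `&` `[0, pi]).
by split => //; [exact: measurableI|rewrite setIC].
Qed.

Lemma circle_mean_ae_le t h1 h2 x (N : set R) : sin t != 0 -> -1 < x < 1 ->
  measurable_fun setT h1 -> measurable_fun setT h2 ->
  (forall y, 0 <= h1 y)%E -> (forall y, 0 <= h2 y)%E ->
  measurable N -> mu N = 0%E ->
  (forall y, -1 < y < 1 -> ~ N y -> (h1 y <= h2 y)%E) ->
  (circle_mean t h1 x <= circle_mean t h2 x)%E.
Proof.
move=> st x11 m1 m2 h10 h20 mN N0 h12.
have mc h : measurable_fun setT h -> measurable_fun [set: R] (fun phi => h (trans_arg t x phi)).
  by move=> mh; exact: (measurableT_comp mh (measurable_trans_arg t x)).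
rewrite /circle_mean integral_itv_bndoo; last by apply: measurable_funTS; exact: mc.
rewrite [leRHS]integral_itv_bndoo; last by apply: measurable_funTS; exact: mc.
apply: ae_ge0_le_integral => //.
- by apply: measurable_funTS; exact: mc.
- by apply: measurable_funTS; exact: mc.
apply: negligibleS (trans_arg_null st x11 mN N0) => phi /= H.
have [+ Hphi] := (not_implyP _ _).1 H; rewrite !in_itv/= => phi0.
have /andP[phi1 phi2] := phi0; split; first by rewrite !ltW.
apply: contrapT => Nphi; apply: Hphi; apply: h12 => //; exact: trans_arg_itv.
Qed.

Lemma circle_mean_hoelder t x (a b : R -> R) (r s : R) :
  measurable_fun setT a -> measurable_fun setT b ->
  (forall y, 0 <= a y) -> (forall y, 0 <= b y) ->
  0 < r -> 0 < s -> r^-1 + s^-1 = 1 ->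
  ((circle_mean t (fun y => (a y * b y)%:E) x) `^ r <=
   circle_mean t (fun y => (a y `^ r)%:E) x *
   (circle_mean t (fun y => (b y `^ s)%:E) x) `^ (r / s))%E.
Proof.
move=> ma mb a0 b0 r0 s0 rs.
pose P (k : R -> R) : R -> R := (k \o trans_arg t x) \_ `[0, pi].
have mc (k : R -> R) : measurable_fun setT k ->
    measurable_fun [set: measurableTypeR R] (P k).
  move=> mk; apply/(measurable_restrictT _ (measurable_itv _)); apply: measurable_funTS.
  exact: (measurableT_comp mk (measurable_trans_arg t x)).
have pw (k : R -> R) (w : R) : 0 < w -> (forall y, 0 <= k y) ->
  circle_mean t (fun y => (k y `^ w)%:E) x =
    (Lnorm mu w%:E (EFin \o P k) `^ w)%E.
  move=> w0 k0; rewrite poweR_Lnorm; last by rewrite gt_eqF.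
  rewrite /circle_mean [LHS]integral_mkcond.
  apply: eq_integral => phi _; rewrite /P /= !patchE; case: ifPn => _ /=.
    by rewrite ger0_norm.
  by rewrite normr0 powR0// gt_eqF.
rewrite (pw a r)// (pw b s)// -poweRrM mulrCA mulfV ?gt_eqF// mulr1.
rewrite -poweRM// ?Lnorm_ge0//.
have r0' := ltW r0; apply: gt0_ler_poweR; rewrite ?in_itv/= ?leey ?andbT//.
- by apply: circle_mean_ge0 => y; rewrite lee_fin mulr_ge0.
- by rewrite mule_ge0// Lnorm_ge0.
rewrite (le_trans _ (hoelder mu (mc _ ma) (mc _ mb) r0 s0 rs))//.
rewrite Lnorm1 /circle_mean [leLHS]integral_mkcond le_eqVlt; apply/orP; left; apply/eqP.
apply: eq_integral => phi _; rewrite /P /= !patchE; case: ifPn => _ /=.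
  by rewrite ger0_norm// mulr_ge0.
by rewrite mul0r normr0.
Qed.

End circle_mean_order.

(** * The weighted Schur test *)

Section weighted_bound.
Variable R : realType.
Notation mu := (@lebesgue_measure R).
Implicit Types (t x y : R).
Notation I11 := (`](-1)%R, 1%R[%classic : set R).

Definition norm11 (p : \bar R) (h : R -> \bar R) : \bar R :=
  Lnorm mu p (h \_ I11).

Lemma norm11_EFin (r : R) h : r != 0 ->
  norm11 r%:E h = ((\int[mu]_(x in I11) `|h x| `^ r) `^ r^-1)%E.
Proof.
move=> r0; rewrite /norm11 unlock /Lnorm [in RHS]integral_mkcond; congr (_ `^ _)%E.
apply: eq_integral => x _; rewrite !patchE; case: ifPn => // _.
by rewrite abse0 poweR0r.
Qed.

Let q x : R := 1 - x ^+ 2.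

Let q_gt0 x : -1 < x < 1 -> 0 < q x.
Proof. by move=> /andP[? ?]; rewrite /q; nra. Qed.

Let mq : measurable_fun [set: R] q.
Proof. by apply: measurable_funB => //; exact: measurable_funX. Qed.

Let mqe (e : R) : measurable_fun [set: R] (fun x => q x `^ e).
Proof. exact: (measurableT_comp (measurable_powR e) mq). Qed.

Let mpow (f : R -> R) (e : R) : measurable_fun [set: R] f ->
  measurable_fun [set: R] (fun x => (f x `^ e)%:E).
Proof.
move=> mf; apply/measurable_EFinP.
exact: (measurableT_comp (measurable_powR e) mf).
Qed.

(** The Hoelder half of the Schur test: the integrand splits into [G * q ^ kappa], with exponent
    [r], and [q ^ (- delta)], with the conjugate exponent [s = r / (r - 1)]. The mean of
    [q ^ (- s * delta)] is controlled by [circle_mean_weight]. At [r = 1] there is no second factor,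
    whence [delta = 0]. *)
Lemma circle_mean_powR (r delta kappa : R) : 1 <= r -> 0 <= delta ->
  (r = 1 -> delta = 0) -> (1 < r -> r / (r - 1) * delta < 2^-1) ->
  exists2 C : R, 0 < C & forall t x (G : R -> R), -1 < x < 1 ->
    measurable_fun setT G -> (forall y, 0 <= G y) ->
    (circle_mean t (fun y => (G y * q y `^ (kappa - delta))%:E) x `^ r <=
     (C * q x `^ (- (r * delta)))%:E *
     circle_mean t (fun y => ((G y * q y `^ kappa) `^ r)%:E) x)%E.
Proof.
move=> r1 d0 dr1 dr; move: r1; rewrite le_eqVlt => /predU1P[r1|r1].
  exists 1 => // t x G x11 mG G0; rewrite -r1 dr1// mulr0 oppr0 powRr0 mulr1 mul1e.
  have G1 y : 0 <= G y * q y `^ kappa by rewrite mulr_ge0 ?powR_ge0.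
  rewrite poweRe1; last by apply: circle_mean_ge0 => y; rewrite lee_fin mulr_ge0 ?powR_ge0.
  rewrite le_eqVlt; apply/orP; left; apply/eqP; congr (circle_mean t _ x).
  by apply/funext => y; rewrite addr0 powRr1.
have r0 : 0 < r by exact: lt_trans r1.
pose s := r / (r - 1).
have s0 : 0 < s by rewrite divr_gt0// subr_gt0.
have sr : r^-1 + s^-1 = 1.
  by rewrite /s invf_div; field; rewrite gt_eqF.
have sd : 0 <= s * delta < 2^-1 by rewrite mulr_ge0 ?(ltW s0)//= dr.
have [C C0 HC] := circle_mean_weight sd.
exists (C `^ (r / s)); first exact: powR_gt0.
move=> t x G x11 mG G0.
have mGk : measurable_fun setT (fun y => G y * q y `^ kappa) by exact: measurable_funM.
have Gk0 y : 0 <= G y * q y `^ kappa by rewrite mulr_ge0 ?powR_ge0.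
rewrite (@eq_circle_mean _ t _ (fun y => ((G y * q y `^ kappa) * q y `^ (- delta))%:E))//; last 5 first.
- by apply/measurable_EFinP; exact: measurable_funM.
- by apply/measurable_EFinP; exact: measurable_funM.
- by move=> y; rewrite lee_fin mulr_ge0 ?powR_ge0.
- by move=> y; rewrite lee_fin mulr_ge0 ?powR_ge0.
- move=> y /q_gt0 qy; rewrite -mulrA -powRD//; by rewrite (gt_eqF qy) implybT.
have b0 y : 0 <= q y `^ (- delta) by exact: powR_ge0.
apply: (le_trans (circle_mean_hoelder t x mGk (mqe _) Gk0 b0 r0 s0 sr)).
rewrite muleC; apply: lee_wpmul2r.
  by apply: circle_mean_ge0 => y; rewrite lee_fin powR_ge0.
apply: (@le_trans _ _ ((C * q x `^ (- (s * delta)))%:E `^ (r / s))%E); last first.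
  rewrite poweR_EFin lee_fin powRM ?powR_ge0 ?(ltW C0)// -powRrM.
  by rewrite (_ : - (s * delta) * (r / s) = - (r * delta))//; field; rewrite gt_eqF.
have rs0 : 0 <= r / s by rewrite divr_ge0 ?(ltW r0) ?(ltW s0).
have cC0 : 0 <= C * q x `^ (- (s * delta)) by rewrite mulr_ge0 ?powR_ge0 ?(ltW C0).
apply: gt0_ler_poweR; rewrite ?in_itv/= ?leey ?andbT//.
  by apply: circle_mean_ge0 => y; rewrite lee_fin powR_ge0.
rewrite (le_trans _ (HC t x x11))//.
rewrite le_eqVlt; apply/orP; left; apply/eqP; congr (circle_mean t _ x).
by apply/funext => y; rewrite -powRrM mulNr mulrC.
Qed.

Let mEFin (f : R -> R) : measurable_fun [set: R] f ->
  measurable_fun [set: R] (fun x => (f x)%:E).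
Proof. by move=> mf; exact/measurable_EFinP. Qed.

Let weighted_mean_eq t (alpha beta : R) (g : R -> R) x : -1 < x < 1 ->
  measurable_fun setT g -> beta = alpha - 1 ->
  circle_mean t (fun y => `|g y * q y|%:E) x =
  circle_mean t (fun y => (`|g y| * q y `^ alpha * q y `^ (- beta))%:E) x.
Proof.
move=> x11 mg ->; apply: eq_circle_mean => //.
- by apply: mEFin; apply: measurableT_comp => //; exact: measurable_funM.
- apply: mEFin; apply: measurable_funM => //; apply: measurable_funM => //.
  exact: measurableT_comp.
- by move=> y; rewrite lee_fin mulr_ge0 ?powR_ge0// mulr_ge0 ?powR_ge0.
move=> y /q_gt0 qy; rewrite normrM (gtr0_norm qy) -mulrA -powRD ?(gt_eqF qy) ?implybT//.
by rewrite (_ : alpha + - (alpha - 1) = 1); [rewrite powRr1// ltW|ring].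
Qed.

(** The dual half: after Hoelder the outer weight is [q ^ (r * (alpha - 1) - r * delta) = q ^ (- r *
    kappa)]. Self-adjointness moves the mean onto this weight, which it reproduces up to a constant,
    and the result cancels the factor [(q ^ kappa) ^ r] inside. *)
Lemma weighted_circle_mean_fin (r alpha delta kappa : R) : 1 <= r -> 0 <= delta ->
  0 <= kappa -> delta - kappa = alpha - 1 ->
  (r = 1 -> delta = 0) -> (1 < r -> r / (r - 1) * delta < 2^-1) ->
  r * kappa < 2^-1 ->
  exists2 C : R, 0 < C & forall t (g : R -> R), sin t != 0 ->
    measurable_fun setT g ->
    (norm11 r%:E (fun x => (q x `^ (alpha - 1))%:E *
                  circle_mean t (fun y => `|g y * q y|%:E) x) <=
     C%:E * norm11 r%:E (fun x => (g x * jacobi_weight alpha x)%:E))%E.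
Proof.
move=> r1 d0 k0 dk dr1 dr rk.
have r0 : 0 < r by exact: lt_le_trans r1.
have [C1 C10 H1] := circle_mean_powR kappa r1 d0 dr1 dr.
have rk2 : 0 <= r * kappa < 2^-1 by rewrite mulr_ge0 ?(ltW r0).
have [C2 C20 H2] := circle_mean_weight rk2.
exists ((C1 * C2) `^ r^-1); first by rewrite powR_gt0 ?mulr_gt0.
move=> t g st mg; rewrite !norm11_EFin ?gt_eqF//.
pose G y := `|g y| * q y `^ alpha.
have G0 y : 0 <= G y by rewrite mulr_ge0 ?powR_ge0.
have mG : measurable_fun setT G.
  by apply: measurable_funM => //; exact: measurableT_comp.
set X := (X in (X `^ _ <= _)%E); set Y := (X in (_ <= _ * X `^ _)%E).
have X0 : (0 <= X)%E by apply: integral_ge0 => x _; exact: poweR_ge0.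
have Y0 : (0 <= Y)%E by apply: integral_ge0 => x _; exact: poweR_ge0.
have C120 : 0 <= C1 * C2 by rewrite mulr_ge0 ?ltW.
have -> : ((C1 * C2) `^ r^-1)%:E = ((C1 * C2)%:E `^ r^-1)%E by rewrite poweR_EFin.
rewrite -poweRM// ?lee_fin//.
have ri : 0 <= r^-1 by rewrite invr_ge0 ltW.
apply: gt0_ler_poweR; rewrite ?in_itv/= ?leey ?andbT ?mule_ge0 ?lee_fin//.
pose h (y : R) : \bar R := ((G y * q y `^ kappa) `^ r)%:E.
have h0 y : (0 <= h y)%E by rewrite lee_fin powR_ge0.
have mh : measurable_fun setT h by apply: mpow; exact: measurable_funM.
pose F (x : R) : \bar R := (q x `^ (- (r * kappa)))%:E.
have F0 y : (0 <= F y)%E by rewrite lee_fin powR_ge0.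
have mF : measurable_fun setT F by apply: mEFin.
have mM k : measurable_fun setT k -> (forall y, 0 <= k y)%E ->
    measurable_fun I11 (circle_mean t k).
  move=> mk kk0; apply/(measurable_restrictT _ (measurable_itv _)).
  exact: measurable_circle_mean.
have mFM : measurable_fun I11 (fun x => F x * circle_mean t h x)%E.
  by apply: emeasurable_funM; [exact: measurable_funTS|exact: mM].
apply: (@le_trans _ _ (\int[mu]_(x in I11) (C1%:E * (F x * circle_mean t h x)))%E).
  rewrite [leLHS]integral_mkcond [leRHS]integral_mkcond.
  apply: ge0_le_integral_nonmeasurable => x; rewrite ?patchE.
    by case: ifPn => // _; exact: poweR_ge0.
  case: ifPn => //; rewrite inE/= in_itv/= => x11; have qx := q_gt0 x11.
  rewrite (@weighted_mean_eq t alpha (delta - kappa))// opprB.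
  set M := circle_mean _ _ _.
  have M0 : (0 <= M)%E.
    by apply: circle_mean_ge0 => y; rewrite lee_fin; exact: mulr_ge0 (G0 y) (powR_ge0 _ _).
  rewrite gee0_abs ?mule_ge0 ?lee_fin ?powR_ge0// poweRM ?lee_fin ?powR_ge0//.
  have qr : (0 <= (q x `^ (alpha - 1))%:E `^ r)%E by exact: poweR_ge0.
  apply: (le_trans (lee_wpmul2l qr (H1 t x G x11 mG G0))).
  rewrite !muleA poweR_EFin -!EFinM; apply: lee_wpmul2r.
    exact: circle_mean_ge0.
  rewrite lee_fin -dk -powRrM mulrCA -powRD ?(gt_eqF qx) ?implybT//.
  by rewrite (_ : (delta - kappa) * r + - (r * delta) = - (r * kappa))//; ring.
rewrite ge0_integralZl_EFin//; last 2 first.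
- by move=> x _; exact: (mule_ge0 (F0 x) (circle_mean_ge0 t x h0)).
- exact: ltW.
rewrite circle_mean_selfadjoint// EFinM -muleA; apply: lee_wpmul2l; first by rewrite lee_fin ltW.
rewrite -ge0_integralZl_EFin//; last 3 first.
- by move=> x _; exact: poweR_ge0.
- apply: measurable_funTS; apply: (measurableT_comp (measurable_poweR r)).
  apply: measurableT_comp => //; apply: mEFin; apply: measurable_funM => //.
  exact: mqe.
- exact: ltW.
rewrite [leLHS]integral_mkcond [leRHS]integral_mkcond.
apply: ge0_le_integral_nonmeasurable => x; rewrite ?patchE.
  by case: ifPn => // _; exact: (mule_ge0 (h0 x) (circle_mean_ge0 t x F0)).
case: ifPn => //; rewrite inE/= in_itv/= => x11; have qx := q_gt0 x11.
apply: (le_trans (lee_wpmul2l (h0 x) (H2 t x x11))).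
have -> : `|g x * jacobi_weight alpha x| = G x.
  by rewrite normrM [`|jacobi_weight _ _|]ger0_norm ?powR_ge0.
rewrite /h -!EFinM lee_fin -/(q x).
rewrite powRM ?powR_ge0// mulrCA ler_wpM2l ?(ltW C20)// -mulrA -powRrM -powRD; last first.
  by rewrite (gt_eqF qx) implybT.
by rewrite mulrC (_ : kappa * r + - (r * kappa) = 0) ?powRr0 ?mul1r//; ring.
Qed.

(* For [p = +oo] the kernel bound is applied to the constant [ess_sup]. *)
Lemma weighted_circle_mean_oo (alpha : R) : 1 <= alpha < 3 / 2 ->
  exists2 C : R, 0 < C & forall t (g : R -> R), sin t != 0 ->
    measurable_fun setT g ->
    (norm11 +oo (fun x => (q x `^ (alpha - 1))%:E *
                  circle_mean t (fun y => `|g y * q y|%:E) x) <=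
     C%:E * norm11 +oo (fun x => (g x * jacobi_weight alpha x)%:E))%E.
Proof.
move=> /andP[a1 a2].
have b2 : 0 <= alpha - 1 < 2^-1 by apply/andP; split; lra.
have [C C0 HC] := circle_mean_weight b2.
exists C => // t g st mg.
have muT : (0 < mu setT)%E.
  rewrite (@lt_le_trans _ _ (mu `[0, 1]))//; last by apply: le_measure; rewrite ?inE.
  by rewrite lebesgue_measure_itv/= lte_fin ltr01 oppr0 adde0 lte_fin.
pose k x := (g x * jacobi_weight alpha x)%:E.
have kS : {ae mu, forall x, (`|(k \_ I11) x| <= norm11 +oo k)%E}.
  rewrite /norm11 unlock /Lnorm muT; exact: ess_sup_ge.
have S0 : (0 <= norm11 +oo k)%E by exact: Lnorm_ge0.
move: kS S0; rewrite -/k; case: (norm11 +oo k) => [s|_ _|//]; last first.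
  by rewrite gt0_muley ?leey// lte_fin.
rewrite lee_fin => -[N [mN N0 kN]] s0.
rewrite /norm11 unlock /Lnorm muT; apply/ess_supP/nearW => x /=.
rewrite patchE; case: ifPn => [|_]; last by rewrite abse0 mule_ge0// lee_fin ltW.
rewrite inE/= in_itv/= => x11; have qx := q_gt0 x11.
rewrite gee0_abs ?mule_ge0 ?lee_fin ?powR_ge0//; last by apply: circle_mean_ge0 => y.
rewrite (@weighted_mean_eq t alpha (alpha - 1))//.
have mG : measurable_fun setT (fun y => `|g y| * q y `^ alpha).
  by apply: measurable_funM => //; exact: measurableT_comp.
apply: (@le_trans _ _ ((q x `^ (alpha - 1))%:E * (s%:E * (C * q x `^ (- (alpha - 1)))%:E))%E).
  apply: lee_wpmul2l; first by rewrite lee_fin powR_ge0.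
  apply: (@le_trans _ _ (s%:E * circle_mean t (fun y => (q y `^ (- (alpha - 1)))%:E) x)%E); last first.
    by apply: lee_wpmul2l; [rewrite lee_fin|exact: HC].
  rewrite -circle_meanZ//; last 2 first.
  - exact: mEFin.
  - by move=> y; rewrite lee_fin powR_ge0.
  (* The bound by [s] holds only off the null set [N], yet the means compare at every [x]. *)
  apply: (circle_mean_ae_le (N := N)) => //.
  - by apply: mEFin; exact: measurable_funM.
  - by apply: mEFin; exact: measurable_funM.
  - by move=> y; rewrite lee_fin mulr_ge0 ?powR_ge0// mulr_ge0 ?powR_ge0.
  - by move=> y; rewrite mule_ge0// lee_fin powR_ge0.
  move=> y y11 Ny; rewrite -EFinM lee_fin ler_wpM2r ?powR_ge0//.
  have : (`|(k \_ I11) y| <= s%:E)%E by apply: contrapT => H; apply: Ny; exact: kN.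
  rewrite patchE ifT; last by rewrite inE/= in_itv.
  by rewrite /k /= lee_fin normrM [`|jacobi_weight _ _|]ger0_norm ?powR_ge0.
have e1 : q x `^ (alpha - 1) * q x `^ (- (alpha - 1)) = 1.
  by rewrite -powRD ?subrr ?powRr0// (gt_eqF qx) implybT.
rewrite -!EFinM lee_fin [leLHS](_ : _ = C * s * (q x `^ (alpha - 1) * q x `^ (- (alpha - 1)))).
  by rewrite e1 mulr1.
by ring.
Qed.

Lemma weighted_circle_mean_bounded (p : \bar R) (alpha : R) :
  (1 <= p)%E -> (p = 1%E -> 1 / 2 < alpha <= 1) ->
  ((1 < p < +oo)%E ->
    1 - 1 / (2 * fine p) < alpha < 3 / 2 - 1 / (2 * fine p)) ->
  (p = +oo%E -> 1 <= alpha < 3 / 2) ->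
  exists2 C : R, 0 < C & forall t (g : R -> R), sin t != 0 ->
    measurable_fun setT g ->
    (norm11 p (fun x => ((1 - x ^+ 2) `^ (alpha - 1))%:E *
                  circle_mean t (fun y => `|g y * (1 - y ^+ 2)|%:E) x) <=
     C%:E * norm11 p (fun x => (g x * jacobi_weight alpha x)%:E))%E.
Proof.
case: p => [r|_ _ _ /(_ erefl)|//]; last exact: weighted_circle_mean_oo.
rewrite lee_fin => r1 h1 hr _.
(* The positive and negative parts of [alpha - 1]. If [1 < r], then
   [r / (r - 1) * (alpha - 1) < 1 / 2] says [alpha < 3 / 2 - 1 / (2 r)], and
   [r * (1 - alpha) < 1 / 2] says [alpha > 1 - 1 / (2 r)]. If [r = 1], then [delta = 0] says
   [alpha <= 1]. *)
pose delta := Num.max (alpha - 1) 0; pose kappa := delta - (alpha - 1).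
have r0 : 0 < r by exact: lt_le_trans r1.
have d0 : 0 <= delta by rewrite le_max lexx orbT.
have k0 : 0 <= kappa by rewrite subr_ge0 le_max lexx.
have dk : delta - kappa = alpha - 1 by rewrite /kappa; ring.
have invr : 1 / (2 * r) * r = 2^-1 by field; rewrite gt_eqF.
have [r1'|r1'] := eqVneq r 1.
  have /andP[a1 a2] := h1 (congr1 EFin r1').
  have dE : delta = 0 by rewrite /delta max_r// subr_le0.
  apply: (@weighted_circle_mean_fin r alpha delta kappa) => //.
  - by rewrite r1' ltxx.
  - by rewrite r1' /kappa dE; lra.
have r1s : 1 < r by rewrite lt_neqAle eq_sym r1'.
have /andP[a1 a2] : 1 - 1 / (2 * r) < alpha < 3 / 2 - 1 / (2 * r).
  by apply: hr; rewrite lte_fin r1s ltry.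
have i0 : 0 < 1 / (2 * r) by rewrite divr_gt0// mulr_gt0.
apply: (@weighted_circle_mean_fin r alpha delta kappa) => //.
- by move=> r1E; move: r1'; rewrite r1E eqxx.
- move=> _; rewrite mulrAC ltr_pdivrMr ?subr_gt0//.
  rewrite /delta; case: (leP (alpha - 1) 0) => _; nra.
- rewrite /kappa /delta; case: (leP (alpha - 1) 0) => _; nra.
Qed.

End weighted_bound.

(** * Lagrange interpolation *)

Section lagrange_interpolation.
Variables (R : fieldType) (n : nat) (x : 'I_n.+1 -> R).

Definition lagrange_coef (c : R) (j : 'I_n.+1) : R :=
  \prod_(i < n.+1 | i != j) ((c - x i) / (x j - x i)).

Lemma lagrange_interpolation (Q : {poly R}) (c : R) : injective x ->
  (size Q <= n.+1)%N -> Q.[c] = \sum_j lagrange_coef c j * Q.[x j].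
Proof.
move=> xinj sQ.
pose ell j : {poly R} := \prod_(i < n.+1 | i != j) ((x j - x i)^-1 *: ('X - (x i)%:P)).
pose L := \sum_j Q.[x j] *: ell j.
have ellE j d : (ell j).[d] = lagrange_coef d j.
  rewrite /ell horner_prod; apply: eq_bigr => i _.
  by rewrite hornerZ hornerXsubC mulrC.
suff QL : Q = L.
  rewrite {1}QL /L horner_sum; apply: eq_bigr => j _.
  by rewrite hornerZ ellE mulrC.
have ell_node j k : (ell j).[x k] = (j == k)%:R.
  rewrite ellE /lagrange_coef; have [<-|jk] := eqVneq j k.
    rewrite big1// => i ij; rewrite divff// subr_eq0; apply: contra_neq ij.
    by move=> /xinj.
  by rewrite (bigD1 k) 1?eq_sym//= subrr !mul0r.
have sell j : (size (ell j) <= n.+1)%N.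
  rewrite /ell (leq_trans (size_prod_leq _ _))//.
  rewrite (eq_bigr (fun=> 2%N)); last first.
    move=> i ij; rewrite size_scale ?size_XsubC// invr_eq0 subr_eq0.
    by apply: contra_neq ij => /xinj.
  rewrite sum_nat_const cardC1 card_ord /= muln2 -addnn.
  by rewrite leq_subLR addnS.
have sL : (size L <= n.+1)%N.
  rewrite (leq_trans (size_sum _ _ _))//; apply/bigmax_leqP => j _.
  by rewrite (leq_trans (size_scale_leq _ _)).
apply/eqP; rewrite -subr_eq0; apply: contraT => QL0.
pose s := [seq x i | i <- enum 'I_n.+1].
have us : uniq s by rewrite map_inj_uniq// enum_uniq.
have rs : all (root (Q - L)) s.
  apply/allP => _ /mapP[k _ ->]; rewrite /root hornerD hornerN /L horner_sum.
  rewrite (bigD1 k)//= big1 ?addr0; last first.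
    by move=> j jk; rewrite hornerZ ell_node (negbTE jk) mulr0.
  by rewrite hornerZ ell_node eqxx mulr1 subrr.
have := max_poly_roots QL0 rs us; rewrite size_map size_enum_ord => /leq_trans.
move=> /(_ n.+1); rewrite ltnn => -> //.
by rewrite (leq_trans (size_polyD _ _))// size_polyN geq_max sQ.
Qed.

End lagrange_interpolation.

(** * Chebyshev polynomials and a quadrature for increments at 1 *)

Section chebyshev.
Variable R : realType.
Implicit Types (c t : R).

Lemma chebyshev_poly n : exists T : {poly R},
  (size T <= n.+1)%N /\ forall t, T.[cos t] = cos (n%:R * t).
Proof.
suff [] : (exists T : {poly R}, (size T <= n.+1)%N /\ forall t, T.[cos t] = cos (n%:R * t)) /\
  (exists T : {poly R}, (size T <= n.+2)%N /\ forall t, T.[cos t] = cos (n.+1%:R * t)) by [].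
elim: n => [|n [[T [sT TE]] [U [sU UE]]]]; split.
- by exists 1; rewrite size_poly1; split => // t; rewrite hornerC mul0r cos0.
- by exists 'X; rewrite size_polyX; split => // t; rewrite hornerX mul1r.
- by exists U.
exists (2%:P * 'X * U - T); split.
  rewrite (leq_trans (size_polyD _ _))// size_polyN geq_max (leq_trans sT) ?andbT; last first.
    by rewrite (leq_trans (leqnSn _)).
  rewrite -mulrA mul_polyC (leq_trans (size_scale_leq _ _))//.
  by rewrite (leq_trans (size_polyMleq _ _))// size_polyX.
move=> t; rewrite hornerD hornerN !hornerM hornerC hornerX TE UE.
have -> : n.+2%:R * t = n.+1%:R * t + t by rewrite -natr1; ring.
have -> : n%:R * t = n.+1%:R * t - t by rewrite -natr1; ring.
by rewrite cosB cosD; ring.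
Qed.

Lemma norm_sin_natr n t : `|sin (n%:R * t)| <= n%:R * `|sin t|.
Proof.
elim: n => [|n IH]; first by rewrite !mul0r sin0 normr0.
rewrite -natr1 !mulrDl !mul1r sinD (le_trans (ler_normD _ _))// !normrM lerD//.
  rewrite (le_trans _ IH)// ler_piMr// ler_norml cos_geN1 cos_le1//.
by rewrite ler_piMl// ler_norml cos_geN1 cos_le1.
Qed.

(** Through [1 - cos s = 2 * sin (s / 2) ^ 2] this is the square of [norm_sin_natr]. For the
    Chebyshev polynomial it reads [1 - T_n(c) <= n ^ 2 * (1 - c)], the increment form of
    [T_n'(1) = n ^ 2]. *)
Lemma onem_cos_natr n t : 1 - cos (n%:R * t) <= n%:R ^+ 2 * (1 - cos t).
Proof.
have half s : 1 - cos s = 2 * `|sin (s / 2)| ^+ 2.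
  have {1}-> : s = s / 2 + s / 2 by lra.
  by rewrite cosD -normrX ger0_norm ?sqr_ge0// -!expr2 cos2sin2; ring.
rewrite !half -[_ * t / 2]mulrA [leRHS]mulrCA -exprMn ler_pM2l//.
rewrite lerXn2r ?nnegrE ?mulr_ge0//.
exact: norm_sin_natr.
Qed.

(* Nodes [x_j] at which a polynomial of degree at most [n] alternates between
   [1] and [-1]: there the Lagrange weights of a point right of [x_1] alternate. *)
Lemma alternating_lagrange_sum n (x : 'I_n.+1 -> R) (Z : {poly R}) c :
  {homo x : i j / (i < j)%N >-> j < i} -> x ord0 = 1 ->
  (size Z <= n.+1)%N -> (forall j, Z.[x j] = (-1) ^+ j) ->
  (forall j, j != ord0 -> x j <= c) -> c <= 1 ->
  \sum_j `|lagrange_coef x c j - (j == ord0)%:R| <= 2 * (1 - Z.[c]).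
Proof.
move=> xdec x0 sZ ZE xc c1.
have xinj : injective x.
  move=> i j; case: (ltngtP i j) => [/xdec|/xdec|/val_inj//] + e; by rewrite e ltxx.
pose l := lagrange_coef x c.
(* The nodes decrease from 1, and [c] lies between the others and 1. Hence the factor of index [i]
   is at most 0 for [0 < i < j] and at least 0 otherwise, which leaves [j - 1] sign changes. *)
have sgn j : j != ord0 -> `|l j| = - ((-1) ^+ j * l j).
  move=> j0.
  pose f (i : 'I_n.+1) := (c - x i) / (x j - x i).
  pose s (i : nat) : R := if (0 < i < j)%N then -1 else 1.
  have jpos : (0 < j)%N by rewrite lt0n.
  have fE i : i != j -> f i = s i * `|f i|.
    rewrite /s /f => ij; have [->|i0] := eqVneq i ord0.
      rewrite ltnn mul1r ger0_norm// x0 -mulrNN -invrN !opprB.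
      by rewrite divr_ge0 ?subr_ge0// ltW// -x0 xdec.
    rewrite lt0n i0 /=; have := xc i i0; rewrite -subr_ge0 => cxi.
    have [ij'|ji] := ltnP i j.
      by rewrite mulN1r ler0_norm ?opprK// -oppr_ge0 -mulrN -invrN opprB divr_ge0// subr_ge0 ltW// xdec.
    rewrite mul1r ger0_norm// divr_ge0// subr_ge0 ltW// xdec// ltn_neqAle ji andbT.
    by rewrite eq_sym; apply: contra_neq ij => /val_inj.
  have -> : l j = - (-1) ^+ j * `|l j|.
    rewrite /l /lagrange_coef normr_prod (eq_bigr _ fE) big_split/=; congr (_ * _).
    rewrite (bigID (fun i : 'I_n.+1 => (0 < i < j)%N))/= [X in _ * X]big1 ?mulr1; last first.
      by move=> i /andP[_ /negbTE h]; rewrite /s h.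
    rewrite (eq_bigr (fun=> -1)); last by move=> i /andP[_ h]; rewrite /s h.
    rewrite (eq_bigl (fun i : 'I_n.+1 => (i < j) && (1 <= i))%N); last first.
      move=> i; rewrite andbC [in RHS]andbC; case: (boolP (0 < i < j)%N) => //= /andP[_ h].
      by apply/negP => /eqP e; move: h; rewrite e ltnn.
    rewrite -(big_mkord (fun i => (i < j) && (1 <= i))%N (fun=> -1)).
    rewrite -(big_nat_widenl 1 0 _ (fun i => i < j)%N)// -(big_nat_widen _ _ _ predT)//=; last exact: ltnW.
    by rewrite prodr_const_nat subn1 -[in RHS](prednK jpos) exprS mulN1r opprK.
  by rewrite normrM normrN normrX normrN1 expr1n mul1r normr_id mulNr mulrN opprK mulrA -exprMn mulrNN mulr1 expr1n mul1r.
have E (Q : {poly R}) : (size Q <= n.+1)%N -> Q.[c] = l ord0 * Q.[x ord0] + \sum_(j | j != ord0) l j * Q.[x j].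
  by move=> sQ; rewrite (lagrange_interpolation c xinj sQ) (bigD1 ord0).
pose S := \sum_(j | j != ord0) `|l j|.
have l0S : 1 - l ord0 <= S.
  have := E 1; rewrite size_poly1 hornerC => /(_ isT).
  rewrite hornerC mulr1 => h; have -> : 1 - l ord0 = \sum_(j | j != ord0) l j.
    by rewrite h addrAC subrr add0r; apply: eq_bigr => j _; rewrite hornerC mulr1.
  by apply: ler_sum => j _; exact: ler_norm.
(* On [Z] each term with [j != ord0] equals minus its absolute value, so interpolating [Z] at [c]
   evaluates the sum of absolute values. *)
have SZ : S = l ord0 - Z.[c].
  rewrite (E Z sZ) ZE expr0 mulr1 opprD addrA subrr add0r -sumrN.
  by apply: eq_bigr => j j0; rewrite sgn// ZE mulrC.
have l01 : l ord0 <= 1.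
  apply: (@le_trans _ _ (\prod_(i < n.+1 | i != ord0) 1)); last by rewrite big1.
  apply: ler_prod => i i0; rewrite x0.
  have xi1 : 0 < 1 - x i by rewrite subr_gt0 -x0 xdec// lt0n.
  rewrite divr_ge0 ?subr_ge0 ?xc//=; last by rewrite -subr_ge0 (ltW xi1).
  by rewrite ler_pdivrMr// mul1r lerB.
rewrite (bigD1 ord0)//= -/(l ord0) distrC ger0_norm ?subr_ge0//.
rewrite (eq_bigr (fun j => `|l j|)); last by move=> j /negbTE ->; rewrite subr0.
rewrite -/S; lra.
Qed.

(** Weights and nodes do not depend on [Q], so the formula can be used under the integral sign,
    simultaneously for all [x] and [phi]. *)
Lemma markov_quadrature N c : (0 < N)%N -> -1 < c <= 1 ->
  exists s : seq (R * R), [/\ forall q, q \in s -> -1 < q.2 <= 1,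
    forall Q : {poly R}, (size Q <= N.+1)%N -> Q.[c] - Q.[1] = \sum_(q <- s) q.1 * Q.[q.2] &
    \sum_(q <- s) `|q.1| <= 8 * N%:R ^+ 2 * (1 - c)].
Proof.
move=> N0 /andP[c0 c1].
have N1 : 0 < N%:R :> R by rewrite ltr0n.
(* The extremal points of the Chebyshev polynomial of degree [N], carried from [-1, 1] to [0, 1]. *)
pose x (j : nat) : R := (1 + cos (j%:R * (pi / N%:R))) / 2.
have [xc|cx] := leP (x 1%N) c; last first.
  (* Here [1 - c] exceeds [1 - x 1 = sin (pi / (2 N)) ^ 2], which is at least [1 / (4 N ^ 2)], so
     the trivial formula of total weight 2 meets the bound. This case dictates the constant 8. *)
  exists [:: (1, c); (-1, 1)]; split.
  - move=> q; rewrite !inE => /orP[] /eqP -> /=; rewrite ?c0//.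
    by rewrite lexx andbT; lra.
  - by move=> Q _; rewrite !big_cons big_nil/= mul1r mulN1r addr0.
  - rewrite !big_cons big_nil/= normrN1 normr1 addr0.
    have e1 : 1 - x 1%N = sin (pi / N%:R / 2) ^+ 2.
      rewrite /x mul1r {1}(_ : pi / N%:R = pi / N%:R / 2 + pi / N%:R / 2); last by lra.
      by rewrite cosD -!expr2 cos2sin2; lra.
    have h0 : 0 <= pi / N%:R / 2 :> R by rewrite !divr_ge0// pi_ge0.
    have h1 : pi / N%:R / 2 <= pi / 2 :> R.
      by rewrite ler_pM2r ?invr_gt0// ler_pdivrMr// ler_peMr ?pi_ge0// ler1n.
    have := @sin_ge_half R (pi / N%:R / 2); rewrite h0 h1 => /(_ isT) h2.
    have h3 : 1 / (2 * N%:R) <= sin (pi / N%:R / 2) :> R.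
      apply: le_trans h2.
      have -> : pi / N%:R / 2 / 2 = (pi / 2) * (1 / (2 * N%:R)) :> R by field; rewrite gt_eqF.
      by rewrite ler_peMl ?pihalf_ge1// divr_ge0// mulr_ge0.
    have h4 : (1 / (2 * N%:R)) ^+ 2 <= 1 - c.
      apply: (@le_trans _ _ (1 - x 1%N)); last by rewrite lerB// ltW.
      rewrite e1 lerXn2r// nnegrE; first by rewrite divr_ge0// mulr_ge0.
      by apply: le_trans h3; rewrite divr_ge0// mulr_ge0.
    apply: (@le_trans _ _ (8 * N%:R ^+ 2 * (1 / (2 * N%:R)) ^+ 2)); last first.
      by rewrite ler_wpM2l// mulr_ge0// sqr_ge0.
    by rewrite le_eqVlt; apply/orP; left; apply/eqP; field; rewrite gt_eqF.
have [T [sT TE]] := chebyshev_poly N.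
pose q : {poly R} := 2%:P * 'X - 1.
pose Z := T \Po q.
have sq : (size q <= 2)%N.
  rewrite (leq_trans (size_polyD _ _))// size_polyN size_poly1 geq_max andbT.
  by rewrite mul_polyC (leq_trans (size_scale_leq _ _))// size_polyX.
have sZ : (size Z <= N.+1)%N.
  rewrite (leq_trans (size_comp_poly_leq _ _))// ltnS.
  rewrite (leq_trans (leq_mul (leqnn _) (_ : _ <= 1)%N)) ?muln1//.
    by rewrite -subn1 leq_subLR.
  by rewrite -subn1 leq_subLR.
have ZE d : Z.[d] = T.[2 * d - 1].
  by rewrite horner_comp /q !hornerE.
have xdec : {homo (fun j : 'I_N.+1 => x j) : i j / (i < j)%N >-> j < i}.
  have hi (k : 'I_N.+1) : k%:R * (pi / N%:R) \in `[0, pi : R].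
    rewrite in_itv/= mulr_ge0 ?divr_ge0 ?pi_ge0//= mulrCA ler_piMr ?pi_ge0//.
    by rewrite ler_pdivrMr// mul1r ler_nat -ltnS.
  move=> i j ij; rewrite /x ltr_pM2r ?invr_gt0// ltrD2l ltr_cos ?hi//.
  by rewrite ltr_pM2r ?ltr_nat// divr_gt0// pi_gt0.
have x0 : x (@ord0 N) = 1 by rewrite /x mul0r cos0; lra.
have Zx (j : 'I_N.+1) : Z.[x j] = (-1) ^+ j.
  have -> : Z.[x j] = cos (j%:R * pi).
    rewrite ZE (_ : 2 * x j - 1 = cos (j%:R * (pi / N%:R))); last by rewrite /x; lra.
    by rewrite TE; congr cos; field; rewrite gt_eqF.
  elim: (j : nat) => [|k IH]; first by rewrite mul0r cos0.
  by rewrite -natr1 mulrDl mul1r cosDpi IH exprS mulN1r.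
have xjc (j : 'I_N.+1) : j != ord0 -> x j <= c.
  move=> j0; apply: le_trans xc; have [->//|j1] := eqVneq (val j) 1%N.
  have lt1 : (1 < N.+1)%N by rewrite ltnS.
  apply: ltW; apply: (xdec (Ordinal lt1) j) => /=.
  by rewrite ltn_neqAle eq_sym j1 lt0n.
have xinj : injective (fun j : 'I_N.+1 => x j).
  by move=> i j; case: (ltngtP i j) => [/xdec|/xdec|/val_inj//] + e; rewrite e ltxx.
pose l := lagrange_coef (fun j : 'I_N.+1 => x j) c.
exists [seq (l j - (j == ord0)%:R, x j) | j <- enum 'I_N.+1]; split.
- move=> _ /mapP[j _ ->]/=; rewrite /x.
  have := cos_geN1 (j%:R * (pi / N%:R) : R); have := cos_le1 (j%:R * (pi / N%:R) : R); lra.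
- move=> Q sQ; rewrite big_map big_enum/= (lagrange_interpolation c xinj sQ).
  rewrite [RHS](eq_bigr (fun j => l j * Q.[x j] - (j == ord0)%:R * Q.[x j])); last by move=> j _; rewrite mulrBl.
  rewrite sumrB; congr (_ - _); rewrite (bigD1 ord0)//= mul1r x0 big1 ?addr0// => j /negbTE ->.
  by rewrite mul0r.
(* [c >= 0] puts [2 c - 1] in the range of [cos], and [onem_cos_natr] gives [2 * (1 - Z.[c]) <= 4 N
   ^ 2 * (1 - c)]. *)
- rewrite big_map big_enum/= (le_trans (alternating_lagrange_sum xdec x0 sZ Zx xjc c1))//.
  have c0' : 0 <= c.
    by apply: le_trans xc; rewrite /x; have := cos_geN1 (1 * (pi / N%:R) : R); lra.
  have cE : cos (acos (2 * c - 1)) = 2 * c - 1 by apply: acosK; rewrite in_itv/=; lra.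
  have := onem_cos_natr N (acos (2 * c - 1)); rewrite -TE cE -ZE.
  have : 0 <= N%:R ^+ 2 * (1 - c) by rewrite mulr_ge0 ?sqr_ge0// subr_ge0.
  by lra.
Qed.

End chebyshev.

(** * Trigonometric polynomials *)

Section trigonometric_polynomials.
Variable R : realType.
Implicit Types (h : R -> R) (d : nat).

(** The normal form modulo [sin ^ 2 + cos ^ 2 = 1], of degree at most [d]. It displays the even part
    [p.[cos t]], the only part that an average over [t] and [- t] keeps. *)
Definition trig_poly d h := exists p r : {poly R},
  [/\ (size p <= d.+1)%N, (size r <= d)%N &
      forall t, h t = p.[cos t] + sin t * r.[cos t]].

Lemma trig_poly_cst d a : trig_poly d (fun=> a).
Proof.
exists a%:P, 0; split=> [||t]; last by rewrite hornerC horner0 mulr0 addr0.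
- by rewrite (leq_trans (size_polyC_leq1 _)).
- by rewrite size_poly0.
Qed.

Lemma trig_poly_cos : trig_poly 1 (@cos R).
Proof.
by exists 'X, 0; split=> [||t]; rewrite ?size_polyX ?size_poly0// hornerX horner0 mulr0 addr0.
Qed.

Lemma trig_poly_sin : trig_poly 1 (@sin R).
Proof.
by exists 0, 1; split=> [||t]; rewrite ?size_poly1 ?size_poly0// horner0 hornerC mulr1 add0r.
Qed.

Lemma trig_polyD d h1 h2 :
  trig_poly d h1 -> trig_poly d h2 -> trig_poly d (fun t => h1 t + h2 t).
Proof.
move=> [p1 [r1 [sp1 sr1 E1]]] [p2 [r2 [sp2 sr2 E2]]]; exists (p1 + p2), (r1 + r2).
split=> [||t]; last by rewrite E1 E2 !hornerD; ring.
- by rewrite (leq_trans (size_polyD _ _))// geq_max sp1.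
- by rewrite (leq_trans (size_polyD _ _))// geq_max sr1.
Qed.

Lemma trig_poly_leq d1 d2 h : (d1 <= d2)%N -> trig_poly d1 h -> trig_poly d2 h.
Proof.
move=> d12 [p [r [sp sr E]]]; exists p, r; split=> //.
- exact: leq_trans sp _.
- exact: leq_trans sr _.
Qed.

Lemma trig_polyM d1 d2 h1 h2 :
  trig_poly d1 h1 -> trig_poly d2 h2 -> trig_poly (d1 + d2) (fun t => h1 t * h2 t).
Proof.
move=> [p1 [r1 [sp1 sr1 E1]]] [p2 [r2 [sp2 sr2 E2]]].
exists (p1 * p2 + (1 - 'X^2) * (r1 * r2)), (p1 * r2 + p2 * r1).
split=> [||t]; last first.
- have e : (1 - 'X^2).[cos t] = sin t ^+ 2 :> R.
    by rewrite hornerD hornerN hornerC hornerXn sin2cos2.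
  rewrite E1 E2 !hornerD (hornerM p1 p2) (hornerM p1 r2) (hornerM p2 r1).
  by rewrite (hornerM (1 - _)) (hornerM r1) e; ring.
- rewrite (leq_trans (size_polyD _ _))// geq_max.
  rewrite !(leq_trans (size_polyMleq _ _))// -subn1 leq_subLR add1n.
    by rewrite addnC -addnS leq_add.
  by rewrite -addSn leq_add.
- rewrite (leq_trans (size_polyD _ _))// geq_max; apply/andP; split.
    by rewrite (leq_trans (size_polyMleq _ _))// -subn1 leq_subLR add1n -addSn -addnS leq_add.
  (* With [r1] and [r2] nonzero, [d1 + d2] is positive, so the predecessor in the bound on the size
     of [r1 * r2] is a true subtraction. *)
  have [->|r10] := eqVneq r1 0; first by rewrite mul0r mulr0 size_poly0.
  have [->|r20] := eqVneq r2 0; first by rewrite !mulr0 size_poly0.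
  have s3 : (size (1 - 'X^2 : {poly R})%R <= 3)%N.
    by rewrite (leq_trans (size_polyD _ _))// size_polyN size_polyXn size_poly1.
  rewrite (leq_trans (size_polyMleq _ _))// -subn1 leq_subLR add1n.
  have s12 : (size (r1 * r2)%R <= (d1 + d2).-1)%N.
    rewrite (leq_trans (size_polyMleq _ _))//.
    by rewrite -!subn1 leq_sub2r// leq_add.
  have d12 : (0 < d1 + d2)%N.
    by rewrite addn_gt0 (leq_trans _ sr1)// lt0n size_poly_eq0.
  by rewrite (leq_trans (leq_add s3 s12))// -[in leqRHS](prednK d12).
Qed.

Lemma trig_polyX d h k : trig_poly d h -> trig_poly (d * k) (fun t => h t ^+ k).
Proof.
move=> hd; elim: k => [|k IH].
  by rewrite muln0; under eq_fun do rewrite expr0; exact: trig_poly_cst.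
by rewrite mulnS; under eq_fun do rewrite exprS; exact: trig_polyM.
Qed.

Lemma trig_polyZ d a h : trig_poly d h -> trig_poly d (fun t => a * h t).
Proof. by move=> hd; rewrite -[d]add0n; apply: trig_polyM => //; exact: trig_poly_cst. Qed.

Lemma trig_poly_horner m (P : {poly R}) h : (size P <= m)%N ->
  trig_poly 1 h -> trig_poly m (fun t => P.[h t]).
Proof.
move=> sP h1; under eq_fun do rewrite horner_coef.
suff H k : (k <= m)%N -> trig_poly m (fun t => \sum_(i < k) P`_i * h t ^+ i) by exact: H.
elim: k => [_|k IH km].
  by under eq_fun do rewrite big_ord0; exact: trig_poly_cst.
under eq_fun do rewrite big_ord_recr/=; apply: trig_polyD; first exact/IH/ltnW.
apply: trig_polyZ; apply: (trig_poly_leq _ (trig_polyX k h1)).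
by rewrite mul1n ltnW.
Qed.

Lemma trig_poly_trans_arg (x phi : R) : trig_poly 1 (fun t => trans_arg t x phi).
Proof.
rewrite /trans_arg; apply: trig_polyD.
  by apply: trig_polyZ; exact: trig_poly_cos.
under eq_fun do rewrite mulrAC -mulNr.
by apply: trig_polyZ; exact: trig_poly_sin.
Qed.

Lemma trig_poly_trans_kernel (x phi : R) : trig_poly 2 (fun t => trans_kernel t x phi).
Proof.
have sin2 : trig_poly 2 (fun t : R => sin t ^+ 2).
  by rewrite -[2%N]mul1n; apply: trig_polyX; exact: trig_poly_sin.
have -> : (fun t => trans_kernel t x phi) = (fun t => 1 + (-1) * trans_arg t x phi ^+ 2 +
   ((- 2 * sin phi ^+ 2) * sin t ^+ 2) + (4 * (1 - x ^+ 2) * sin phi ^+ 4) * sin t ^+ 2).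
  by apply/funext => t; rewrite /trans_kernel; ring.
do ?apply: trig_polyD; try by apply: trig_polyZ.
- exact: trig_poly_cst.
- apply: trig_polyZ; rewrite -[2%N]mul1n; apply: trig_polyX.
  exact: trig_poly_trans_arg.
Qed.

End trigonometric_polynomials.

(** * Translation of polynomials *)

Section polynomial_translation.
Variable R : realType.
Notation mu := (@lebesgue_measure R).
Implicit Types (t x phi : R) (h : R -> R) (P : {poly R}).

Lemma integrable_0pi h : continuous h -> mu.-integrable `[0, pi] (EFin \o h).
Proof.
move=> ch; apply: continuous_compact_integrable; first exact: segment_compact.
by apply: continuous_subspaceT.
Qed.

Lemma Rintegral_reflect h : continuous h ->
  (\int[mu]_(phi in `[0, pi]) h phi = \int[mu]_(phi in `[0, pi]) h (pi - phi))%R.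
Proof.
move=> ch; rewrite /Rintegral; congr fine.
have mh : measurable_fun [set: R] (EFin \o h).
  by apply/measurable_EFinP; exact: continuous_measurable_fun.
rewrite integralE [RHS]integralE; congr (_ - _)%E.
- rewrite (ge0_integral_reflect _ (measurable_funepos mh)) => [|y]; last exact: funepos_ge0.
  by apply: eq_integral => x _; rewrite !funeposE.
- rewrite (ge0_integral_reflect _ (measurable_funeneg mh)) => [|y]; last exact: funeneg_ge0.
  by apply: eq_integral => x _; rewrite !funenegE.
Qed.

(** Continuity is proved in the same induction because additivity of the integral asks for
    integrability of the tail. *)
Lemma Rintegral_sum (s : seq (R * R)) (G : R -> R -> R) : (forall t, continuous (G t)) ->
  continuous (fun phi => \sum_(q <- s) q.1 * G q.2 phi) /\
  (\int[mu]_(phi in `[0, pi]) (\sum_(q <- s) q.1 * G q.2 phi)%R =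
   \sum_(q <- s) q.1 * \int[mu]_(phi in `[0, pi]) G q.2 phi)%R.
Proof.
move=> cG; elim: s => [|q s [IHc IH]].
  rewrite big_nil; under eq_fun do rewrite big_nil; split; first by move=> ?; exact: cvg_cst.
  by rewrite Rintegral_cst// mul0r.
have cq : continuous (fun phi => q.1 * G q.2 phi).
  by move=> phi; apply: cvgM; [exact: cvg_cst|exact: cG].
split.
  under eq_fun do rewrite big_cons.
  by move=> phi; apply: cvgD; [exact: cq|exact: IHc].
under eq_Rintegral do rewrite big_cons.
rewrite RintegralD//; [|exact: integrable_0pi|exact: integrable_0pi].
by rewrite big_cons IH RintegralZl//; exact: integrable_0pi.
Qed.

Lemma continuous_trans_kernel t x : continuous (trans_kernel t x).
Proof.
move=> phi; rewrite /trans_kernel.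
have cs k : continuous (fun phi : R => sin phi ^+ k).
  by move=> u; apply: (@continuous_comp _ _ _ sin (fun y => y ^+ k)); [exact: continuous_sin|exact: exprn_continuous].
apply: cvgD; last by apply: cvgM; [exact: cvg_cst|exact: cs].
apply: cvgB; last by apply: cvgM; [exact: cvg_cst|exact: cs].
apply: cvgB; first exact: cvg_cst.
apply: (@continuous_comp _ _ _ (trans_arg t x) (fun y => y ^+ 2)).
  exact: continuous_trans_arg.
exact: exprn_continuous.
Qed.

Lemma continuous_trans_integrand t x P :
  continuous (fun phi => trans_kernel t x phi * P.[trans_arg t x phi]).
Proof.
move=> phi; apply: cvgM; first exact: continuous_trans_kernel.
apply: (@continuous_comp _ _ _ (trans_arg t x) (horner P)); first exact: continuous_trans_arg.
exact: continuous_horner.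
Qed.

Definition poly_translation t P x : R := (pi * (1 - x ^+ 2))^-1 *
  (\int[mu]_(phi in `[0, pi]) (trans_kernel t x phi * P.[trans_arg t x phi])%R)%R.

Lemma gen_translation_horner t P x :
  gen_translation t (horner P) x = (poly_translation t P x)%:E.
Proof.
rewrite /gen_translation /poly_translation EFinM; congr (_ * _)%E.
have ci := @continuous_trans_integrand t x P.
rewrite /Rintegral fineK; last exact: integrable_fin_num (integrable_0pi ci).
rewrite integral_completed//.
by apply: measurable_funTS; apply/measurable_EFinP; exact: continuous_measurable_fun.
Qed.

Lemma trans_kernelNt t x phi : trans_kernel (- t) x phi = trans_kernel t x (pi - phi).
Proof.
rewrite /trans_kernel trans_argNt sinN sqrrN; congr (_ - _ * _ ^+ 2 + _ * _ ^+ 4);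
by rewrite sinB sinpi cospi; ring.
Qed.

Lemma trans_arg0 x phi : trans_arg 0 x phi = x.
Proof. by rewrite /trans_arg cos0 sin0; ring. Qed.

Lemma trans_kernel0 x phi : trans_kernel 0 x phi = 1 - x ^+ 2.
Proof. by rewrite /trans_kernel trans_arg0 sin0; ring. Qed.

Lemma poly_translation0 P x : -1 < x < 1 -> poly_translation 0 P x = P.[x].
Proof.
move=> x11; rewrite /poly_translation.
under eq_Rintegral do rewrite trans_arg0 trans_kernel0.
rewrite Rintegral_cst//= lebesgue_measure_itv/= lte_fin pi_gt0/= oppr0 addr0.
rewrite invfM; have u0 : 1 - x ^+ 2 != 0 by rewrite gt_eqF//; nra.
have pi0 : pi != 0 :> R by rewrite gt_eqF// pi_gt0.
move: (1 - x ^+ 2) (pi : R) u0 pi0 => u q u0 q0.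
by field; rewrite u0 q0.
Qed.

(* For fixed [phi] the even part in [t] of the integrand is a polynomial in
   [cos t], and the reflection [phi -> pi - phi] makes the integral even in [t]. *)
Lemma poly_translation_quadrature m P t x (s : seq (R * R)) : -1 < x < 1 ->
  (size P <= m)%N -> (forall q, q \in s -> -1 < q.2 <= 1) ->
  (forall Q : {poly R}, (size Q <= m.+3)%N ->
    Q.[cos t] - Q.[1] = \sum_(q <- s) q.1 * Q.[q.2]) ->
  poly_translation t P x - P.[x] = \sum_(q <- s) q.1 * poly_translation (acos q.2) P x.
Proof.
move=> x11 sP s11 quad.
pose G t phi := trans_kernel t x phi * P.[trans_arg t x phi].
have cG u : continuous (G u) by exact: continuous_trans_integrand.
have cG' u : continuous (fun phi => G u (pi - phi)).
  move=> phi; apply: (@continuous_comp _ _ _ (fun y => pi - y) (G u)); last exact: cG.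
  by apply: cvgB; [exact: cvg_cst|exact: cvg_id].
pose H u phi := G u phi + G u (pi - phi).
have cH u : continuous (H u) by move=> phi; apply: cvgD; [exact: cG|exact: cG'].
have HE phi : exists2 Q : {poly R}, (size Q <= m.+3)%N & forall u, H u phi = Q.[cos u].
  have [p [r [sp _ E]]] : trig_poly m.+2 (G ^~ phi).
    rewrite -[m.+2]add2n; apply: trig_polyM; first exact: trig_poly_trans_kernel.
    by apply: trig_poly_horner => //; exact: trig_poly_trans_arg.
  exists (p + p) => [|u]; first by rewrite (leq_trans (size_polyD _ _))// maxnn.
  have -> : H u phi = G u phi + G (- u) phi.
    by rewrite /H /G trans_kernelNt trans_argNt.
  by rewrite !E cosN sinN hornerD; ring.
have quadH phi : H t phi - H 0 phi = \sum_(q <- s) q.1 * H (acos q.2) phi.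
  have [Q sQ QE] := HE phi; rewrite !QE cos0 quad//.
  apply: eq_big_seq => q /s11 /andP[q1 q2]; rewrite QE acosK// in_itv/= q2 andbT.
  exact: ltW.
have iH u : (\int[mu]_(phi in `[0, pi]) H u phi = 2 * \int[mu]_(phi in `[0, pi]) G u phi)%R.
  rewrite RintegralD//; [|exact: integrable_0pi|exact: integrable_0pi].
  by rewrite -Rintegral_reflect// mulrDl mul1r.
have [_ Sum] := @Rintegral_sum s (fun c => H (acos c)) (fun c => cH (acos c)).
have : (\int[mu]_(phi in `[0, pi]) (H t phi - H 0 phi) =
        \int[mu]_(phi in `[0, pi]) \sum_(q <- s) q.1 * H (acos q.2) phi)%R.
  by apply: eq_Rintegral => phi _; exact: quadH.
rewrite RintegralB//; [|exact: integrable_0pi|exact: integrable_0pi].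
rewrite Sum !iH => e.
rewrite -(poly_translation0 P x11) /poly_translation -mulrBr.
have half (a b : R) : a - b = 2^-1 * (2 * a - 2 * b) by lra.
rewrite -/(G t) -/(G 0) [X in _ * X]half e !mulr_sumr.
by apply: eq_bigr => q _; rewrite iH /G; lra.
Qed.

End polynomial_translation.

Lemma poly_translationD (R : realType) t (P Q : {poly R}) x :
  poly_translation t (P + Q) x = poly_translation t P x + poly_translation t Q x.
Proof.
rewrite /poly_translation -mulrDr -RintegralD//; try
  by apply: integrable_0pi; exact: continuous_trans_integrand.
by congr (_ * _); apply: eq_Rintegral => phi _; rewrite hornerD mulrDr.
Qed.

(** * Size and total mass of the translation kernel *)

Section translation_bounds.
Variable R : realType.
Notation mu := (@lebesgue_measure R).
Implicit Types (t x phi : R) (h : R -> R) (P : {poly R}).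

(* Law of sines on the sphere: [sin t sin phi = sqrt (1 - y^2) sin psi] and
   [sqrt (1 - x^2) sin phi = sqrt (1 - y^2) sin chi] for [y = trans_arg t x phi]. *)
Lemma trans_kernel_le t x phi : -1 < x < 1 ->
  `|trans_kernel t x phi| <= 5 * (1 - trans_arg t x phi ^+ 2).
Proof.
move=> x11; have := trans_arg_ge t phi x11.
have : sin t ^+ 2 * sin phi ^+ 2 <= 1 - trans_arg t x phi ^+ 2.
  have /andP[? ?] := x11.
  have : Num.sqrt (1 - x ^+ 2) ^+ 2 = 1 - x ^+ 2 by rewrite sqr_sqrtr; nra.
  rewrite -subr_ge0 /trans_arg; set u := Num.sqrt _ => u2.
  suff -> : 1 - (x * cos t - u * sin t * cos phi) ^+ 2 - sin t ^+ 2 * sin phi ^+ 2 =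
    (cos t * u + x * sin t * cos phi) ^+ 2 by exact: sqr_ge0.
  have u2' : 1 - x ^+ 2 - u ^+ 2 = 0 by rewrite u2 subrr.
  have t2 : 1 - sin t ^+ 2 - cos t ^+ 2 = 0 by rewrite sin2cos2; ring.
  apply/eqP; rewrite -subr_eq0 (sin2cos2 phi); apply/eqP.
  transitivity ((1 - sin t ^+ 2 - cos t ^+ 2) +
      (cos t ^+ 2 + sin t ^+ 2 * cos phi ^+ 2) * (1 - x ^+ 2 - u ^+ 2)); first by ring.
  by rewrite u2' t2; ring.
rewrite /trans_kernel.
have -> : sin phi ^+ 4 = sin phi ^+ 2 * sin phi ^+ 2 by ring.
have -> : 4 * (1 - x ^+ 2) * sin t ^+ 2 * (sin phi ^+ 2 * sin phi ^+ 2) =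
   4 * ((sin t ^+ 2 * sin phi ^+ 2) * ((1 - x ^+ 2) * sin phi ^+ 2)) by ring.
rewrite -[2 * _ * _]mulrA.
have b0 : 0 <= (1 - x ^+ 2) * sin phi ^+ 2.
  by rewrite mulr_ge0 ?sqr_ge0//; move/andP: x11 => [? ?]; nra.
have a0 : 0 <= sin t ^+ 2 * sin phi ^+ 2 by rewrite mulr_ge0 ?sqr_ge0.
have v1 : 1 - trans_arg t x phi ^+ 2 <= 1 by rewrite lerBlDr lerDl sqr_ge0.
move: (1 - trans_arg t x phi ^+ 2) v1 (sin t ^+ 2 * _) a0 ((1 - x ^+ 2) * _) b0.
move=> v v1 a a0 b b0 av bv.
have ab0 : 0 <= a * b by rewrite mulr_ge0.
(* The kernel is now [v - 2 a + 4 a b] with [0 <= a, b <= v <= 1]; it lies between [- v] and [5 v],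
   whence the constant 5. *)
have abv : a * b <= v by nra.
by rewrite ler_norml; apply/andP; split; lra.
Qed.

(** This makes translations fix constants, which is where the telescoping over degrees starts. *)
Lemma Rintegral_trans_kernel t x : -1 < x < 1 ->
  (\int[mu]_(phi in `[0, pi]) trans_kernel t x phi)%R = pi * (1 - x ^+ 2).
Proof.
move=> /andP[x1 x2].
have : Num.sqrt (1 - x ^+ 2) ^+ 2 = 1 - x ^+ 2 by rewrite sqr_sqrtr; nra.
set u := Num.sqrt _ => u2.
(* A primitive of [sin ^ 4]. The derivative of [F] below differs from the kernel by a multiple of
   [1 - sin phi ^ 2 - cos phi ^ 2]. *)
pose S4 phi : R := 3 / 8 * phi - 3 / 8 * (sin phi * cos phi) - sin phi ^+ 3 * cos phi / 4.
pose F phi : R := phi - (x ^+ 2 * cos t ^+ 2 * phi - 2 * (x * cos t * u * sin t) * sin phi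
   + u ^+ 2 * sin t ^+ 2 * ((phi + sin phi * cos phi) / 2))
   - sin t ^+ 2 * (phi - sin phi * cos phi) + 4 * (1 - x ^+ 2) * sin t ^+ 2 * S4 phi.
have dF phi : is_derive phi 1 F (trans_kernel t x phi).
  rewrite /F /S4; apply: is_derive_eq.
  rewrite /trans_kernel /trans_arg -/u /GRing.scale/=.
  apply/eqP; rewrite -subr_eq0; apply/eqP.
  transitivity ((1 - sin phi ^+ 2 - cos phi ^+ 2) * (4 * (1 - x ^+ 2) * sin t ^+ 2 *
    (3 / 8 + 3 / 4 * sin phi ^+ 2) - u ^+ 2 * sin t ^+ 2 / 2 - sin t ^+ 2)); first by field.
  by rewrite sin2cos2; ring.
have derF phi : derivable F phi 1 by have [] := dF phi.
have cF : continuous F.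
  by move=> phi; apply/differentiable_continuous/derivable1_diffP; exact: derF.
rewrite /Rintegral (@continuous_FTC2 R _ F) ?pi_gt0//=; last 3 first.
- by apply: continuous_subspaceT; exact: continuous_trans_kernel.
- split=> [phi _||]; first exact: derF.
    by apply: cvg_at_right_filter; exact: cF.
  by apply: cvg_at_left_filter; exact: cF.
- by move=> phi _; rewrite derive1E; have [_ ->] := dF phi.
by rewrite /F /S4 sin0 sinpi cospi cos0 u2 (sin2cos2 t); field.
Qed.

Lemma poly_translationC t (c : R) x : -1 < x < 1 -> poly_translation t c%:P x = c.
Proof.
move=> x11; rewrite /poly_translation; under eq_Rintegral do rewrite hornerC.
rewrite RintegralZr//; last by apply: integrable_0pi; exact: continuous_trans_kernel.
rewrite Rintegral_trans_kernel// mulrA mulVf ?mul1r// mulf_neq0// ?gt_eqF ?pi_gt0//.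
by move/andP: x11 => [? ?]; nra.
Qed.

End translation_bounds.

(** * Norm estimates through measurable majorants *)

Section dominated.
Variables (R : realType) (p : \bar R) (alpha : R).
Hypothesis p1 : (1 <= p)%E.
Notation mu := (@lebesgue_measure R).
Notation I11 := (`](-1)%R, 1%R[%classic : set R).
Implicit Types (A G : R -> \bar R) (b : \bar R) (x : R).

Definition weighted_norm11 G : \bar R :=
  norm11 p (fun x => G x * (jacobi_weight alpha x)%:E)%E.

(* The majorant [G] carries the measurability, so that nothing has to be proved
   about the measurability in [x] of translates. *)
Definition dominated A b := exists G, [/\ measurable_fun setT G,
  forall x, (0 <= G x)%E, forall x, -1 < x < 1 -> (`|A x| <= G x)%E &
  (weighted_norm11 G <= b)%E].

Lemma measurable_jacobi_weight : measurable_fun setT (jacobi_weight alpha).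
Proof.
apply: (measurableT_comp (measurable_powR alpha)).
by apply: measurable_funB => //; exact: measurable_funX.
Qed.

Lemma measurable_weighted G : measurable_fun setT G ->
  measurable_fun setT ((fun x => G x * (jacobi_weight alpha x)%:E)%E \_ I11).
Proof.
move=> mG; apply/(measurable_restrictT _ (measurable_itv _)); apply: measurable_funTS.
by apply: emeasurable_funM => //; apply/measurable_EFinP; exact: measurable_jacobi_weight.
Qed.

Lemma dominated_le A A' b b' : dominated A b -> (b <= b')%E ->
  (forall x, -1 < x < 1 -> (`|A' x| <= `|A x|)%E) -> dominated A' b'.
Proof.
move=> [G [mG G0 AG Gb]] bb' AA'; exists G; split => //.
- by move=> x x11; rewrite (le_trans (AA' x x11))// AG.
- exact: le_trans Gb bb'.
Qed.

Lemma dominatedD A1 A2 A b1 b2 : dominated A1 b1 -> dominated A2 b2 ->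
  (forall x, -1 < x < 1 -> (`|A x| <= `|A1 x| + `|A2 x|)%E) -> dominated A (b1 + b2)%E.
Proof.
move=> [G1 [m1 G10 AG1 Gb1]] [G2 [m2 G20 AG2 Gb2]] AA.
exists (fun x => G1 x + G2 x)%E; split => //.
- exact: emeasurable_funD.
- by move=> x; rewrite adde_ge0.
- by move=> x x11; rewrite (le_trans (AA x x11))// leeD ?AG1 ?AG2.
apply: le_trans (leeD Gb1 Gb2).
rewrite /weighted_norm11 /norm11.
have wge0 (G : R -> \bar R) : (forall x, 0 <= G x)%E ->
    forall x, (0 <= ((fun x => G x * (jacobi_weight alpha x)%:E) \_ I11) x)%E.
  by move=> G0 x; rewrite patchE; case: ifPn => // _; rewrite mule_ge0// lee_fin powR_ge0.
apply: (le_trans _ (@Lnorm_ge0D _ (measurableTypeR R) _ mu p _ _ p1 (measurable_weighted m1)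
  (measurable_weighted m2) (wge0 _ G10) (wge0 _ G20))).
apply: le_Lnorm => // x; rewrite /= !patchE; case: ifPn => _; last by rewrite addr0.
by rewrite ge0_muleDl.
Qed.

Lemma dominatedZ A A' b (k : R) : 0 <= k -> dominated A b ->
  (forall x, -1 < x < 1 -> (`|A' x| <= k%:E * `|A x|)%E) -> dominated A' (k%:E * b)%E.
Proof.
move=> k0 [G [mG G0 AG Gb]] AA'; exists (fun x => k%:E * G x)%E; split => //.
- exact: measurable_funeM.
- by move=> x; rewrite mule_ge0// lee_fin.
- by move=> x x11; rewrite (le_trans (AA' x x11))// lee_wpmul2l// ?lee_fin// AG.
apply: le_trans (lee_wpmul2l _ Gb); last by rewrite lee_fin.
rewrite /weighted_norm11 /norm11 -(@LnormZ_ge0 _ (measurableTypeR R) _ mu p _ _ p1 k0 (measurable_weighted mG)).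
apply: le_Lnorm => // x; rewrite !patchE; case: ifPn => _; last by rewrite mule0.
by rewrite muleA.
Qed.

Lemma dominated0 : dominated (fun=> 0%E) 0%E.
Proof.
exists (fun=> 0%E); split => // [x|]; first by rewrite abse0.
rewrite /weighted_norm11 /norm11.
rewrite (_ : _ \_ _ = cst 0%E); first by rewrite Lnorm0// gt_eqF// (lt_le_trans _ p1).
by apply/funext => x; rewrite patchE; case: ifPn => // _; rewrite mul0e.
Qed.

Lemma dominated_sum (I : eqType) (s : seq I) (w : I -> R) (B : I -> R -> R) b :
  (0 <= b)%E -> (forall i, i \in s -> dominated (EFin \o B i) b) ->
  dominated (fun x => (\sum_(i <- s) w i * B i x)%:E) ((\sum_(i <- s) `|w i|)%:E * b)%E.
Proof.
move=> b0; elim: s => [_|i s IH H].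
  apply: dominated_le dominated0 _ _ => [|x _]; first by rewrite big_nil mul0e.
  by rewrite big_nil.
rewrite big_cons EFinD ge0_muleDl ?lee_fin ?sumr_ge0//.
have Hi : dominated (fun x => (w i * B i x)%:E) (`|w i|%:E * b)%E.
  apply: (@dominatedZ (EFin \o B i)) => //; first by apply: H; rewrite mem_head.
  by move=> x _; rewrite /= normrM.
apply: dominatedD Hi (IH _) _ => [j js|x _]; first by apply: H; rewrite inE js orbT.
by rewrite big_cons /= lee_fin ler_normD.
Qed.

(** Links the closed segment of the norm with the open interval of the majorants: at the endpoints
    the weighted function is 0 whatever the translate is there, [+oo * 0] being 0. *)
Lemma jacobi_weight_endpoint x : 0 < alpha -> x \in @unit_segment R -> x \notin I11 ->
  jacobi_weight alpha x = 0.
Proof.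
move=> a0; rewrite inE /unit_segment/= in_itv/= => /andP[x1 x2].
rewrite notin_setE/= in_itv/= => /negP; rewrite negb_and -!leNgt => /orP[] h;
  rewrite /jacobi_weight (_ : 1 - x ^+ 2 = 0) ?powR0 ?gt_eqF//.
  by rewrite (_ : x = -1); [ring|apply/le_anti; rewrite h x1].
by rewrite (_ : x = 1); [ring|apply/le_anti; rewrite h x2].
Qed.

Lemma dominated_weighted_norm A b : 0 < alpha -> dominated A b ->
  (weighted_norm p alpha A <= b)%E.
Proof.
move=> a0 [G [mG G0 AG Gb]]; apply: le_trans Gb.
rewrite /weighted_norm /Lp_norm /weighted_norm11 /norm11.
rewrite -Lnorm_completed//; last exact: measurable_weighted.
apply: le_Lnorm => // x; rewrite !patchE.
case: ifPn => [xI|_]; last by rewrite abse0 abse_ge0.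
case: ifPn => [|xI'].
  rewrite inE/= in_itv/= => /AG AGx.
  rewrite !abseM [`|G x|%E]gee0_abs// lee_wpmul2r//.
by rewrite jacobi_weight_endpoint// mule0.
Qed.

End dominated.

(** * Bounded translations and the Bernstein inequality *)

Section dominated_translation.
Variables (R : realType) (p : \bar R) (alpha C : R).
Hypotheses (p1 : (1 <= p)%E) (C0 : 0 < C).
Notation mu := (@lebesgue_measure R).
Notation I11 := (`](-1)%R, 1%R[%classic : set R).
Implicit Types (t x y phi : R) (g : R -> R) (P Q : {poly R}).

Hypothesis C_bound : forall t g, sin t != 0 -> measurable_fun setT g ->
  (norm11 p (fun x => ((1 - x ^+ 2) `^ (alpha - 1))%:E *
                  circle_mean t (fun y => `|g y * (1 - y ^+ 2)|%:E) x) <=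
   C%:E * norm11 p (fun x => (g x * jacobi_weight alpha x)%:E))%E.

Lemma norm_sin_le t : `|sin t| <= `|t|.
Proof.
wlog t0 : t / 0 <= t.
  move=> H; case: (leP 0 t) => [|t0]; first exact: H.
  by rewrite -normrN -sinN -(normrN t) H// oppr_ge0 ltW.
have [c _] := @MVT_segment R sin cos 0 t t0 (fun x _ => is_derive_sin x)
  (continuous_subspaceT (@continuous_sin R)).
rewrite sin0 !subr0 => ->; rewrite normrM ler_piMl//.
by rewrite ler_norml cos_geN1 cos_le1.
Qed.

Lemma onem_cos_le t : 1 - cos t <= t ^+ 2 / 2.
Proof.
have {1}-> : t = t / 2 + t / 2 by lra.
have : sin (t / 2) ^+ 2 <= (t / 2) ^+ 2.
  by rewrite -real_normK ?num_real// -[leRHS]real_normK ?num_real// lerXn2r ?nnegrE// norm_sin_le.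
rewrite cosD -!expr2 cos2sin2; lra.
Qed.

(** The 5 comes from [trans_kernel_le], the rest from the prefactor of the translation. *)
Definition mean_bound t g x : \bar R :=
  ((5 / pi * (1 - x ^+ 2)^-1)%:E * circle_mean t (fun y => `|g y * (1 - y ^+ 2)|%:E) x)%E.

Let mk g : measurable_fun setT g ->
  measurable_fun setT (fun y => `|g y * (1 - y ^+ 2)|%:E).
Proof.
move=> mg; apply/measurable_EFinP; apply: measurableT_comp => //.
by apply: measurable_funM => //; apply: measurable_funB => //; exact: measurable_funX.
Qed.

Lemma mean_bound_ge0 t g x : -1 < x < 1 -> (0 <= mean_bound t g x)%E.
Proof.
move=> /andP[? ?]; rewrite /mean_bound mule_ge0//; last by apply: circle_mean_ge0 => y; rewrite lee_fin.
by rewrite lee_fin mulr_ge0 ?divr_ge0 ?pi_ge0// invr_ge0; nra.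
Qed.

Lemma dominated_mean_bound t g : sin t != 0 -> measurable_fun setT g ->
  dominated p alpha (mean_bound t g) ((5 / pi * C)%:E * weighted_norm11 p alpha (EFin \o g))%E.
Proof.
move=> st mg.
(* Measurability of the mean is known after restriction to the open interval, so the majorant is
   built from the restricted mean. *)
pose cm := circle_mean t (fun y => `|g y * (1 - y ^+ 2)|%:E) \_ I11.
have mcm : measurable_fun [set: R] cm by apply: measurable_circle_mean => //; exact: mk.
have mw e : measurable_fun [set: R] (fun x => ((1 - x ^+ 2) `^ e)%:E).
  by apply/measurable_EFinP; exact: measurable_jacobi_weight.
have cmE x : -1 < x < 1 -> cm x = circle_mean t (fun y => `|g y * (1 - y ^+ 2)|%:E) x.
  by move=> x11; rewrite /cm patchE ifT// inE/= in_itv.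
have cm0 x : (0 <= cm x)%E.
  by rewrite /cm patchE; case: ifPn => // _; apply: circle_mean_ge0 => y; rewrite lee_fin.
have k0 : 0 <= 5 / pi :> R by rewrite divr_ge0// pi_ge0.
exists (fun x => (5 / pi)%:E * (((1 - x ^+ 2) `^ (-1))%:E * cm x))%E; split.
- by apply: measurable_funeM; exact: emeasurable_funM.
- by move=> x; rewrite !mule_ge0// lee_fin powR_ge0.
- move=> x x11; rewrite gee0_abs ?mean_bound_ge0// /mean_bound -cmE// EFinM -muleA powR_inv1//.
  by move/andP: x11 => [? ?]; nra.
rewrite (EFinM (5 / pi)) -muleA; apply: le_trans (lee_wpmul2l _ (C_bound st mg)); last by rewrite lee_fin.
rewrite /weighted_norm11 /norm11.
have mh : measurable_fun [set: R] ((fun x => ((1 - x ^+ 2) `^ (alpha - 1))%:E *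
    circle_mean t (fun y => `|g y * (1 - y ^+ 2)|%:E) x)%E \_ I11).
  rewrite (_ : _ \_ _ = (fun x => ((1 - x ^+ 2) `^ (alpha - 1))%:E * cm x)%E).
    exact: emeasurable_funM.
  by apply/funext => x; rewrite /cm !patchE; case: ifPn => // _; rewrite mule0.
rewrite -(@LnormZ_ge0 _ (measurableTypeR R) _ mu p _ _ p1 k0 mh).
apply: le_Lnorm => // x; rewrite !patchE; case: ifPn => [|_]; last by rewrite mule0.
rewrite inE/= in_itv/= => x11; rewrite -cmE//; move/andP: x11 => [x1 x2].
have q0 : 0 < 1 - x ^+ 2 by nra.
rewrite -muleA [(_ * cm x * _)%E]muleAC -EFinM.
suff -> : (1 - x ^+ 2) `^ (-1) * jacobi_weight alpha x = (1 - x ^+ 2) `^ (alpha - 1) by [].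
by rewrite /jacobi_weight [alpha - 1]addrC powRD// (gt_eqF q0) implybT.
Qed.

Lemma le_abs_trans_integral t g x : -1 < x < 1 -> measurable_fun setT g ->
  (\int[mu]_(phi in `[0%R, pi]) `|(trans_kernel t x phi * g (trans_arg t x phi))%:E| <=
   5%:E * circle_mean t (fun y => `|g y * (1 - y ^+ 2)|%:E) x)%E.
Proof.
move=> x11 mg.
have mKg : measurable_fun [set: R] (fun phi => (trans_kernel t x phi * g (trans_arg t x phi))%:E).
  apply/measurable_EFinP; apply: measurable_funM.
    by apply: continuous_measurable_fun; exact: continuous_trans_kernel.
  exact: (measurableT_comp mg (measurable_trans_arg t x)).
have mkx : measurable_fun [set: R] (fun phi => `|g (trans_arg t x phi) * (1 - trans_arg t x phi ^+ 2)|%:E).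
  exact: (measurableT_comp (mk mg) (measurable_trans_arg t x)).
rewrite /circle_mean -ge0_integralZl_EFin//; last exact: measurable_funTS.
apply: ge0_le_integral => //.
- by apply: measurable_funTS; exact: measurableT_comp.
- by apply: measurable_funTS; exact: measurable_funeM.
move=> phi _; rewrite /= lee_fin !normrM [leRHS]mulrCA mulrC ler_wpM2l//.
apply: (le_trans (trans_kernel_le t phi x11)).
by rewrite ler_wpM2l// ler_norm.
Qed.

Lemma le_gen_translation t g x : -1 < x < 1 -> measurable_fun setT g ->
  (`|gen_translation t g x| <= mean_bound t g x)%E.
Proof.
move=> x11 mg; have x11' := x11; move: x11' => /andP[x1 x2].
have q0 : 0 < 1 - x ^+ 2 by nra.
have mKg : measurable_fun [set: R] (fun phi => (trans_kernel t x phi * g (trans_arg t x phi))%:E).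
  apply/measurable_EFinP; apply: measurable_funM.
    by apply: continuous_measurable_fun; exact: continuous_trans_kernel.
  exact: (measurableT_comp mg (measurable_trans_arg t x)).
rewrite /gen_translation integral_completed//; last exact: measurable_funTS.
rewrite abseM /mean_bound.
have -> : (`|(pi * (1 - x ^+ 2))^-1%:E| = (pi * (1 - x ^+ 2))^-1%:E :> \bar R)%E.
  by rewrite gee0_abs// lee_fin invr_ge0 mulr_ge0 ?pi_ge0// ltW.
have -> : (5 / pi * (1 - x ^+ 2)^-1)%:E = ((pi * (1 - x ^+ 2))^-1%:E * 5%:E)%E :> \bar R.
  by rewrite -EFinM invfM; congr EFin; ring.
rewrite -muleA; apply: lee_wpmul2l.
  by rewrite lee_fin invr_ge0 mulr_ge0 ?pi_ge0// ltW.
apply: (le_trans (le_abse_integral mu (measurable_itv _) (measurable_funTS mKg))).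
exact: le_abs_trans_integral.
Qed.

(** If the right-hand side is infinite nothing is to be shown. If it is finite, the integrand for
    [g - P] is integrable, and only then may the extended-real integral for [g] be split. *)
Lemma gen_translationB t g P x : -1 < x < 1 -> measurable_fun setT g ->
  (`|gen_translation t g x - (poly_translation t P x)%:E| <=
   mean_bound t (fun y => g y - P.[y])%R x)%E.
Proof.
move=> x11 mg; have x11' := x11; move: x11' => /andP[x1 x2].
have q0 : 0 < 1 - x ^+ 2 by nra.
have mP : measurable_fun [set: R] (horner P).
  by apply: continuous_measurable_fun; exact: continuous_horner.
have md : measurable_fun [set: R] (fun y => g y - P.[y]) by exact: measurable_funB.
have [->|] := eqVneq (mean_bound t (fun y => g y - P.[y]) x) +oo%E; first exact: leey.
rewrite -ltey => fin.
have mc h : measurable_fun setT h ->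
    measurable_fun [set: R] (fun phi => trans_kernel t x phi * h (trans_arg t x phi)).
  move=> mh; apply: measurable_funM.
    by apply: continuous_measurable_fun; exact: continuous_trans_kernel.
  exact: (measurableT_comp mh (measurable_trans_arg t x)).
have iP : mu.-integrable `[0, pi] (EFin \o (fun phi => trans_kernel t x phi * P.[trans_arg t x phi])).
  by apply: integrable_0pi; exact: continuous_trans_integrand.
have id : mu.-integrable `[0, pi] (EFin \o (fun phi => trans_kernel t x phi * (g (trans_arg t x phi) - P.[trans_arg t x phi]))).
  apply/integrableP; split.
    by apply: measurable_funTS; apply/measurable_EFinP; exact: (mc _ md).
  apply: (le_lt_trans (le_abs_trans_integral t x11 md)).
  rewrite lte_mul_pinfty//; move: fin; rewrite /mean_bound.
  case: (circle_mean _ _ _) => [r _|+|_]; [exact: ltry| |by []].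
  by rewrite gt0_muley ?ltxx// lte_fin mulr_gt0 ?invr_gt0// divr_gt0// pi_gt0.
have -> : gen_translation t g x =
    (gen_translation t (fun y => (g y - P.[y])%R) x + (poly_translation t P x)%:E)%E.
  rewrite -gen_translation_horner /gen_translation !integral_completed//;
    try by apply: measurable_funTS; apply/measurable_EFinP;
      first [exact: (mc _ mg)|exact: (mc _ mP)|exact: (mc _ md)].
  rewrite -muleDr//; last first.
    by rewrite fin_num_adde_defl// integrable_fin_num.
  congr (_ * _)%E; rewrite -integralD_EFin//; apply: eq_integral => phi _.
  by rewrite -EFinD -mulrDr subrK.
rewrite addeK//; exact: le_gen_translation.
Qed.

Notation wnorm g := (weighted_norm11 p alpha (EFin \o g)).

Lemma dominated_self g : measurable_fun setT g -> dominated p alpha (EFin \o g) (wnorm g).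
Proof.
move=> mg; exists (fun x => `|g x|%:E); split => //.
  by apply/measurable_EFinP; exact: measurableT_comp.
apply: le_Lnorm => // x; rewrite !patchE; case: ifPn => _ //=.
by rewrite lee_fin !normrM normr_id.
Qed.

(** One constant for three bounds: [1] for the identity, [5 / pi * C] for a translation with
    [sin t != 0], and their sum for the difference of the two. *)
Let D : R := 1 + 5 / pi * C.

Let D0 : 0 < D.
Proof. by rewrite ltr_wpDr// mulr_ge0 ?(ltW C0)// divr_ge0// pi_ge0. Qed.

Let measurable_horner P : measurable_fun setT (horner P).
Proof. by apply: continuous_measurable_fun; exact: continuous_horner. Qed.

Let D_ge1 : 1 <= D. Proof. by rewrite lerDl mulr_ge0 ?(ltW C0)// divr_ge0// pi_ge0. Qed.

Let D_ge : 5 / pi * C <= D. Proof. by rewrite lerDr. Qed.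

Lemma wnorm_ge0 g : (0 <= wnorm g)%E.
Proof. exact: Lnorm_ge0. Qed.

Lemma dominated_poly_translation c Q : -1 < c <= 1 ->
  dominated p alpha (EFin \o poly_translation (acos c) Q) (D%:E * wnorm (horner Q))%E.
Proof.
(* The node [c = 1] is the translation by 0: outside the scope of the kernel bound, but the
   identity. *)
move=> /andP[c0]; rewrite le_eqVlt => /predU1P[->|c1].
  rewrite acos1; apply: dominated_le (dominated_self (measurable_horner Q)) _ _ => [|x x11].
    by rewrite -[leLHS]mul1e lee_wpmul2r ?wnorm_ge0// lee_fin D_ge1.
  by rewrite /= poly_translation0.
have st : sin (acos c) != 0.
  rewrite sin_acos ?(ltW c0) ?(ltW c1)// gt_eqF// sqrtr_gt0; nra.
apply: dominated_le (dominated_mean_bound st (measurable_horner Q)) _ _ => [|x x11].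
  by rewrite lee_wpmul2r ?wnorm_ge0// lee_fin D_ge.
rewrite [leRHS]gee0_abs ?mean_bound_ge0// [(EFin \o _) x]/comp -gen_translation_horner.
exact: le_gen_translation.
Qed.

(** The quadrature at [cos t] bounds the increment by its total weight times the norm of a
    translate; [8 * (1 - cos t) <= 4 * t ^ 2] gives the 4. *)
Lemma dominated_poly_translationB t m Q : `|t| <= 1 -> (size Q <= m)%N ->
  dominated p alpha (fun x => (poly_translation t Q x - Q.[x])%:E)
    ((4 * m.+2%:R ^+ 2 * t ^+ 2 * D)%:E * wnorm (horner Q))%E.
Proof.
move=> t1 sQ; have ct := onem_cos_le t.
have t2 : t ^+ 2 <= 1 by rewrite -real_normK ?num_real// expr_le1.
have ct1 : -1 < cos t <= 1 by rewrite cos_le1 andbT; lra.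
have [s [s11 sE sw]] := @markov_quadrature R m.+2 (cos t) isT ct1.
have := @dominated_sum R p alpha p1 _ s (fun q => q.1)
  (fun q => poly_translation (acos q.2) Q) (D%:E * wnorm (horner Q))%E.
move=> /(_ _ (fun q qs => dominated_poly_translation Q (s11 q qs))) H.
apply: dominated_le (H _) _ _ => [||x x11].
- by rewrite mule_ge0 ?wnorm_ge0// lee_fin ltW.
- rewrite EFinM -muleA lee_wpmul2r//.
    by rewrite mule_ge0 ?wnorm_ge0// lee_fin ltW.
  rewrite lee_fin (le_trans sw)//.
  have : 0 <= 8 * m.+2%:R ^+ 2 :> R by rewrite mulr_ge0// sqr_ge0.
  by move=> /ler_wpM2l /(_ _ _ ct); lra.
- by rewrite (@poly_translation_quadrature R m Q t x s).
Qed.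

Lemma dominated_gen_translationB t g P b : sin t != 0 -> measurable_fun setT g ->
  dominated p alpha (fun x => (poly_translation t P x - P.[x])%:E) b ->
  dominated p alpha (fun x => gen_translation t g x - (g x)%:E)%E
    (D%:E * wnorm (fun x => g x - P.[x])%R + b)%E.
Proof.
move=> st mg Pb; have mgP : measurable_fun [set: R] (fun x => g x - P.[x]).
  by apply: measurable_funB => //; exact: measurable_horner.
pose A1 x := (mean_bound t (fun y => g y - P.[y])%R x + `|g x - P.[x]|%:E)%E.
have d1 : dominated p alpha A1 (D%:E * wnorm (fun x => g x - P.[x])%R)%E.
  rewrite /D addrC EFinD ge0_muleDl ?lee_fin//; last first.
    by rewrite mulr_ge0 ?(ltW C0)// divr_ge0// pi_ge0.
  rewrite mul1e; apply: dominatedD (dominated_mean_bound st mgP) (dominated_self mgP) _ => // x x11.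
  by rewrite (le_trans (lee_abs_add _ _))//= normr_id.
apply: dominatedD d1 Pb _ => // x x11.
have h := gen_translationB t P x11 mg.
rewrite [(`|A1 x|)%E]gee0_abs; last by rewrite /A1 adde_ge0 ?mean_bound_ge0.
(* The two real terms are inserted so that the identity also holds when the translate of [g] is
   infinite. *)
have -> : (gen_translation t g x - (g x)%:E = (gen_translation t g x - (poly_translation t P x)%:E) +
   (- (g x - P.[x])%:E) + (poly_translation t P x - P.[x])%:E)%E.
  case: (gen_translation t g x) => //= r; rewrite -!EFinD; congr EFin; ring.
apply: (le_trans (lee_abs_add _ _)); rewrite leeD2r//.
apply: (le_trans (lee_abs_add _ _)); rewrite abseN; exact: leeD2r.
Qed.

End dominated_translation.

(** * Replacing a function by a Borel version *)

Section borel_version.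
Variables (R : realType) (p : \bar R) (alpha : R).
Hypotheses (p1 : (1 <= p)%E) (a0 : 0 < alpha).
Notation mu := (@lebesgue_measure R).
Notation cmu := (@completed_lebesgue_measure R).
Notation I11 := (`](-1)%R, 1%R[%classic : set R).
Notation GR := (measurableTypeR R).
Notation LR := (lebesgueType R).
Implicit Types (t x y phi : R) (f g : R -> R) (P Q : {poly R}) (N : set R).

Lemma negligible_completed N : mu.-negligible N -> cmu.-negligible (N : set LR).
Proof.
move=> [A [mA A0 NA]]; exists A; split => //.
exact: borel_lebesgue_measurable.
Qed.

(** The assumption concerns [f] times the weight. That product is Borel off a null set, and on the
    open interval it can be divided by the weight, which is positive there. *)
Lemma in_Lw_borel f : in_Lw p alpha f -> exists g N,
  [/\ measurable_fun [set: R] g, @measurable _ GR N, mu N = 0%E &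
      forall x, -1 < x < 1 -> ~ N x -> g x = f x].
Proof.
move=> [mf _].
have [|N [mN N0 mfN]] := @completed_measurable_fun_null R (@unit_segment R) _ _ mf.
  exact: measurable_itv.
pose D := I11 `\` N.
have mD : @measurable _ GR D by apply: measurableD => //; exact: measurable_itv.
have mfD : measurable_fun D (fun x => f x * jacobi_weight alpha x * jacobi_weight (- alpha) x).
  apply: measurable_funM; last by apply: measurable_funTS; exact: measurable_jacobi_weight.
  apply: measurable_funS mfN; first by apply: measurableD => //; exact: measurable_itv.
  apply: setSD => x /=; rewrite !in_itv/= => /andP[? ?]; apply/andP; split; exact: ltW.
exists ((fun x => f x * jacobi_weight alpha x * jacobi_weight (- alpha) x) \_ D), N; split => //.
  exact/(measurable_restrictT _ mD).
move=> x x11 Nx; rewrite patchE ifT; last first.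
  by rewrite inE /D/= in_itv.
have q0 : 0 < 1 - x ^+ 2 by move/andP: x11 => [? ?]; nra.
by rewrite -mulrA /jacobi_weight powRN divff ?mulr1// gt_eqF// powR_gt0.
Qed.

Section version.
Variables (f g : R -> R) (N : set R).
Hypotheses (mg : measurable_fun [set: R] g) (mN : @measurable _ GR N)
  (N0 : mu N = 0%E) (gf : forall x, -1 < x < 1 -> ~ N x -> g x = f x).

Lemma weighted_norm_version P :
  weighted_norm p alpha (fun x => (f x - P.[x])%:E) =
  weighted_norm11 p alpha (EFin \o (fun x => g x - P.[x])).
Proof.
have mgP : measurable_fun [set: R] (EFin \o (fun x => g x - P.[x])).
  apply/measurable_EFinP; apply: measurable_funB => //.
  by apply: continuous_measurable_fun; exact: continuous_horner.
have mh := measurable_weighted alpha mgP.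
rewrite /weighted_norm11 /norm11 -Lnorm_completed// /weighted_norm /Lp_norm.
have mh' := measurable_fun_completed (@measurableT _ GR) mh.
set h1 := (X in Lnorm _ _ X = _); set h2 := (X in _ = Lnorm _ _ X).
have hE x : ~ N x -> h2 x = h1 x.
  move=> Nx; rewrite /h1 /h2 !patchE.
  case: ifPn => [|xI'].
    rewrite inE/= in_itv/= => x11; rewrite ifT; last first.
      by rewrite inE /unit_segment/= in_itv/=; case/andP: x11 => /ltW -> /ltW ->.
    by rewrite /= gf.
  by case: ifPn => // xI; rewrite jacobi_weight_endpoint// mule0.
have mN' := borel_lebesgue_measurable mN.
have mh1 : @measurable_fun _ _ LR _ setT h1.
  apply: (ae_measurable_fun (@completed_lebesgue_measure_is_complete R) _ mh').
  by exists N; split => // x /=; apply: contra_notP => Nx _; exact: hE.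
apply: ae_eq_Lnorm => //.
by exists N; split => // x /=; apply: contra_notP => Nx; rewrite -hE.
Qed.

(** The angles at which the circle meets [N] form a null set by [trans_arg_null]. The angles 0 and
    [pi] join the exceptional set, since the height may be 1 or -1 there, where [g] and [f] are
    unrelated. *)
Lemma gen_translation_version t x : sin t != 0 -> -1 < x < 1 ->
  gen_translation t f x = gen_translation t g x.
Proof.
move=> st x11; rewrite /gen_translation; congr (_ * _)%E.
have mKg : measurable_fun [set: R] (fun phi => (trans_kernel t x phi * g (trans_arg t x phi))%:E).
  apply/measurable_EFinP; apply: measurable_funM.
    by apply: continuous_measurable_fun; exact: continuous_trans_kernel.
  exact: (measurableT_comp mg (measurable_trans_arg t x)).
have mKg' : @measurable_fun _ _ LR _ `[0, pi]
    (fun phi => (trans_kernel t x phi * g (trans_arg t x phi))%:E).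
  by apply: measurable_fun_completed; [exact: measurable_itv|exact: measurable_funTS].
have ae : ae_eq cmu (`[0, pi]%classic : set R) (fun phi => (trans_kernel t x phi * g (trans_arg t x phi))%:E)
   (fun phi => (trans_kernel t x phi * f (trans_arg t x phi))%:E).
  have : cmu.-negligible (([set 0] `|` [set pi]) `|` (`[0, pi] `&` trans_arg t x @^-1` N) : set LR).
    apply: negligible_completed; apply: negligibleU; last exact: trans_arg_null.
    have n1 a : mu.-negligible [set a].
      by exists [set a]; split => //; exact: lebesgue_measure_set1.
    exact: negligibleU.
  move=> [Z [mZ Z0 ZP]]; exists Z; split => //; apply: subset_trans ZP.
  move=> phi /not_implyP[phiI H].
  have [->|phi0] := eqVneq phi 0; first by left; left.
  have [->|phipi] := eqVneq phi pi; first by left; right.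
  right; split => //; apply: contra_notP H => Nx; rewrite gf//.
  move: phiI => /=; rewrite in_itv/= => /andP[p0 ppi].
  by apply: trans_arg_itv => //; rewrite !lt_neqAle eq_sym phi0 p0 phipi.
apply: ae_eq_integral.
- exact: borel_lebesgue_measurable.
- exact: (ae_measurable_fun (@completed_lebesgue_measure_is_complete R) ae).
- exact: mKg'.
- move: ae => [Z [mZ Z0 ZP]]; exists Z; split => //; apply: subset_trans ZP.
  by move=> phi /=; apply: contra_not => h D; rewrite h.
Qed.

(** The majorant is [+oo] on the null set and 0 elsewhere. *)
Lemma dominated_null (A : R -> \bar R) :
  (forall x, -1 < x < 1 -> ~ N x -> A x = 0%E) -> dominated p alpha A 0%E.
Proof.
move=> A0; pose G : R -> \bar R := cst +oo%E \_ N.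
have mG : measurable_fun [set: R] G by exact/(measurable_restrictT _ mN).
exists G; split => //.
- by move=> x; rewrite /G patchE; case: ifPn => // _; rewrite leey.
- move=> x x11; rewrite /G patchE; case: ifPn => [_|]; first exact: leey.
  by rewrite notin_setE => /(A0 _ x11) ->; rewrite abse0.
rewrite /weighted_norm11 /norm11.
have -> : (0 = 'N[mu]_p[cst 0%R])%E by rewrite Lnorm0// gt_eqF// (lt_le_trans _ p1).
rewrite le_eqVlt; apply/orP; left; apply/eqP.
apply: ae_eq_Lnorm => //; first exact: measurable_weighted.
exists N; split => // x /=; apply: contra_notP => Nx; rewrite !patchE; case: ifPn => // _.
by rewrite /G patchE ifF ?mul0e//; apply/negbTE; rewrite notin_setE.
Qed.

Lemma dominated_version t b : sin t != 0 ->
  dominated p alpha (fun x => gen_translation t g x - (g x)%:E)%E b ->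
  dominated p alpha (fun x => gen_translation t f x - (f x)%:E)%E b.
Proof.
move=> st gb.
(* Off [N] the increments of [f] and [g] coincide; [A] pays for the points of [N] at no cost in
   norm. *)
pose A x := (if x \in N then gen_translation t f x - (f x)%:E else 0)%E.
have dA : dominated p alpha A 0%E.
  by apply: dominated_null => x _ Nx; rewrite /A memNset.
rewrite -[b]adde0; apply: dominatedD gb dA _ => // x x11.
rewrite gen_translation_version//; rewrite /A.
case: ifPn => [_|]; first by rewrite gen_translation_version// leeDr.
by rewrite notin_setE => Nx; rewrite gf// abse0 adde0.
Qed.

End version.

Lemma gen_translation0 f x : -1 < x < 1 -> gen_translation 0 f x = (f x)%:E.
Proof.
move=> x11; rewrite /gen_translation.
under eq_integral do rewrite trans_arg0 trans_kernel0.
rewrite integral_completed//.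
rewrite integral_cst//= lebesgue_measure_itv/= lte_fin pi_gt0/= oppr0 addr0 -!EFinM.
congr EFin; have u0 : 1 - x ^+ 2 != 0 by rewrite gt_eqF//; move/andP: x11 => [? ?]; nra.
have pi0 : pi != 0 :> R by rewrite gt_eqF// pi_gt0.
move: (1 - x ^+ 2) (pi : R) u0 pi0 => u q u0 q0.
by field; rewrite u0 q0.
Qed.

End borel_version.

(** * Condensation of sums over dyadic degrees *)

Section dyadic_sum.
Variable R : realType.

(** Cauchy condensation: the block [2 ^ k < nu <= 2 ^ k.+1] has [2 ^ k] terms, each at least
    [2 ^ k * e (2 ^ k.+1)], so 4 times the block covers [4 ^ k.+1 * e (2 ^ k.+1)]. *)
Lemma dyadic_sum_le (e : nat -> R) : (forall n, 0 <= e n) ->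
  (forall m n, (0 < m <= n)%N -> e n <= e m) -> forall k,
  \sum_(j < k.+1) 4 ^+ j * e (2 ^ j)%N <= 4 * \sum_(1 <= nu < (2 ^ k).+1) nu%:R * e nu.
Proof.
move=> e0 edec; elim=> [|k IH].
  by rewrite big_ord_recl big_ord0 expr0 big_nat1 !mul1r addr0 ler_peMl// ler1n.
rewrite big_ord_recr/= (@big_cat_nat _ _ _ (2 ^ k).+1)//=; last first.
  by rewrite ltnS leq_exp2l.
rewrite mulrDr lerD//.
apply: (@le_trans _ _ (4 * \sum_((2 ^ k).+1 <= nu < (2 ^ k.+1).+1) 2 ^+ k * e (2 ^ k.+1)%N)).
  have card : ((2 ^ k.+1).+1 - (2 ^ k).+1 = 2 ^ k)%N by rewrite subSS expnS mul2n -addnn addnK.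
  rewrite sumr_const_nat card -[X in 4 * X]mulr_natl natrX mulrA [_ ^+ k.+1]exprS.
  rewrite (_ : 4 ^+ k = 2 ^+ k * 2 ^+ k) ?mulrA// -exprMn; congr (_ ^+ _); ring.
rewrite ler_wpM2l//; apply: ler_sum_nat => nu /andP[nu1 nu2]; apply: ler_pM => //.
- by rewrite -natrX ler_nat ltnW.
- by apply: edec; rewrite (leq_trans _ nu1)//= -ltnS.
Qed.

End dyadic_sum.

(** * Telescoping and conclusion *)

Section assembly.
Variables (R : realType) (p : \bar R) (alpha C : R).
Hypotheses (p1 : (1 <= p)%E) (a0 : 0 < alpha) (C0 : 0 < C).
Implicit Types (t x : R) (f g : R -> R) (P Q : {poly R}).

Hypothesis C_bound : forall t g, sin t != 0 -> measurable_fun setT g ->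
  (norm11 p (fun x => ((1 - x ^+ 2) `^ (alpha - 1))%:E *
                  circle_mean t (fun y => `|g y * (1 - y ^+ 2)|%:E) x) <=
   C%:E * norm11 p (fun x => (g x * jacobi_weight alpha x)%:E))%E.

Notation wnorm g := (weighted_norm11 p alpha (EFin \o g)).
Let D : R := 1 + 5 / pi * C.

Let D0 : 0 < D.
Proof. by rewrite ltr_wpDr// mulr_ge0 ?(ltW C0)// divr_ge0// pi_ge0. Qed.

Lemma wnormB_le g P Q (a b : \bar R) : measurable_fun [set: R] g ->
  (wnorm (fun x => g x - P.[x])%R <= a)%E -> (wnorm (fun x => g x - Q.[x])%R <= b)%E ->
  (wnorm (horner (P - Q)) <= a + b)%E.
Proof.
move=> mg Pa Qb.
have mB P' : measurable_fun [set: R] (fun x => g x - P'.[x]).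
  by apply: measurable_funB => //; apply: continuous_measurable_fun; exact: continuous_horner.
have dP := dominated_le (dominated_self alpha p1 (mB P)) Pa (fun x _ => lexx _).
have dQ := dominated_le (dominated_self alpha p1 (mB Q)) Qb (fun x _ => lexx _).
have [] := dominatedD p1 dP dQ (A := EFin \o horner (P - Q)).
  move=> x _; rewrite /= lee_fin hornerD hornerN -normrN.
  by rewrite (_ : - (P.[x] - Q.[x]) = (g x - P.[x]) - (g x - Q.[x])) ?ler_normB//; ring.
move=> G [mG G0 PG Gb]; apply: le_trans Gb; rewrite /weighted_norm11 /norm11.
apply: le_Lnorm => // x; rewrite !patchE; case: ifPn => // xI.
rewrite !abseM lee_wpmul2r// (gee0_abs (G0 x)) PG//.
by move: xI; rewrite inE/= in_itv.
Qed.

Lemma dominated_dyadic g (e : nat -> R) (P : nat -> {poly R}) t k :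
  measurable_fun [set: R] g -> (forall n, 0 <= e n) ->
  (forall m n, (0 < m <= n)%N -> e n <= e m) ->
  (forall n, (0 < n)%N -> (size (P n) <= n)%N) ->
  (forall n, (0 < n)%N -> (wnorm (fun x => g x - (P n).[x])%R <= (e n)%:E)%E) ->
  `|t| <= 1 ->
  dominated p alpha (fun x => (poly_translation t (P (2 ^ k)%N) x - (P (2 ^ k)%N).[x])%:E)
    (128 * D * t ^+ 2 * \sum_(j < k) 4 ^+ j * e (2 ^ j)%N)%:E.
Proof.
move=> mg e0 edec sP eP t1; elim: k => [|k IH].
  rewrite big_ord0 mulr0; apply: dominated_le (dominated0 alpha p1) _ _ => // x x11.
  (* The telescoping starts at a constant polynomial, which translations fix. *)
  have -> : P (2 ^ 0)%N = ((P 1%N)`_0)%:P by apply: size1_polyC; exact: sP.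
  by rewrite poly_translationC// hornerC subrr.
have pos j : (0 < 2 ^ j)%N by rewrite expn_gt0.
pose Q := P (2 ^ k.+1)%N - P (2 ^ k)%N.
have sQ : (size Q <= 2 ^ k.+1)%N.
  rewrite (leq_trans (size_polyD _ _))// size_polyN geq_max sP//=.
  by rewrite (leq_trans (sP _ _))// leq_exp2l.
have e21 : e (2 ^ k.+1)%N <= e (2 ^ k)%N by apply: edec; rewrite pos/= leq_exp2l//.
have Qn : (wnorm (horner Q) <= (2 * e (2 ^ k)%N)%:E)%E.
  have := wnormB_le mg (eP _ (pos k.+1)) (eP _ (pos k)).
  move=> /le_trans; apply; rewrite -EFinD lee_fin; lra.
have dQ := dominated_poly_translationB p1 C0 C_bound t1 sQ.
rewrite big_ord_recr/= mulrDr EFinD.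
apply: dominatedD IH (dominated_le dQ _ (fun x _ => lexx _)) _ => // [|x x11].
  apply: le_trans (lee_wpmul2l _ Qn) _.
    by rewrite lee_fin mulr_ge0 ?(ltW D0)// mulr_ge0 ?sqr_ge0// mulr_ge0 ?sqr_ge0//.
  rewrite -EFinM lee_fin -/D.
  (* [128 = 4 * 16 * 2]: the Bernstein constant, this bound for the degree, and the norm of [Q], at
     most [2 * e (2 ^ k)]. *)
  have h : ((2 ^ k.+1).+2%:R : R) ^+ 2 <= 16 * 4 ^+ k.
    have -> : 16 * 4 ^+ k = ((4 * 2 ^ k)%N%:R : R) ^+ 2.
      by rewrite natrM natrX exprMn -exprM mulnC exprM; congr (_ * _ ^+ _); ring.
    by rewrite lerXn2r ?nnegrE// ler_nat expnS -addn2 (_ : 4 = 2 + 2)%N// mulnDl leq_add2l leq_pmulr ?pos.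
  have : 0 <= t ^+ 2 * D * e (2 ^ k)%N by rewrite mulr_ge0 ?e0// mulr_ge0 ?sqr_ge0 ?(ltW D0).
  by move=> /ler_wpM2r /(_ _ _ h); lra.
have PQ : P (2 ^ k.+1)%N = P (2 ^ k)%N + Q by rewrite /Q addrC subrK.
rewrite PQ poly_translationD hornerD /= lee_fin.
by rewrite (_ : _ + _ - _ = (poly_translation t (P (2 ^ k)%N) x - (P (2 ^ k)%N).[x]) +
  (poly_translation t Q x - Q.[x])) ?ler_normD//; ring.
Qed.

Lemma sin_neq0 t : `|t| <= 1 -> t != 0 -> sin t != 0.
Proof.
move=> t1 t0; have : `|t| / 2 <= sin `|t|.
  by apply: sin_ge_half; rewrite normr_ge0 (le_trans t1)// pihalf_ge1.
rewrite -normr_gt0 in t0; move=> h; have : 0 < sin `|t| by lra.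
by case: (ger0P t) => _ h'; [rewrite gt_eqF|rewrite -oppr_eq0 -sinN gt_eqF].
Qed.

Lemma best_approx_ge0 f n : (0 <= best_approx p alpha f n)%E.
Proof. by apply: le_ereal_inf_tmp => _ [P _ <-]; exact: Lnorm_ge0. Qed.

Lemma best_approx_fin f n : in_Lw p alpha f -> best_approx p alpha f n \is a fin_num.
Proof.
move=> [_ fin]; rewrite ge0_fin_numE ?best_approx_ge0//; apply: le_lt_trans fin.
apply: ereal_inf_lbound; exists 0; first by rewrite /= size_poly0.
rewrite /weighted_norm; congr (Lp_norm p _); apply/funext => x.
by rewrite horner0 subr0.
Qed.

Lemma best_approx_decr f m n : (m <= n)%N ->
  (best_approx p alpha f n <= best_approx p alpha f m)%E.
Proof.
move=> mn; apply: ereal_inf_le_tmp => _ [P sP <-]; exists P => //=.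
exact: leq_trans mn.
Qed.

Lemma dominated_translationB f g (N : set R) (e : nat -> R) n t :
  measurable_fun [set: R] g -> measurable (N : set (measurableTypeR R)) ->
  lebesgue_measure N = 0%E -> (forall x, -1 < x < 1 -> ~ N x -> g x = f x) ->
  (0 < n)%N -> (forall n, 0 <= e n) -> (forall m n, (0 < m <= n)%N -> e n <= e m) ->
  (forall n, exists P : {poly R}, (size P <= n)%N /\
     (weighted_norm p alpha (fun x => (f x - P.[x])%:E) <= (e n)%:E)%E) ->
  `|t| <= n%:R^-1 ->
  dominated p alpha (fun x => gen_translation t f x - (f x)%:E)%E
    (512 * D / n%:R ^+ 2 * \sum_(1 <= nu < n.+1) nu%:R * e nu)%:E.
Proof.
move=> mg mN N0 gf n0 e0 edec eP tn.
have n0' : 0 < n%:R :> R by rewrite ltr0n.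
have t1 : `|t| <= 1 by rewrite (le_trans tn)// invf_le1// ler1n.
have S0 m : 0 <= \sum_(1 <= nu < m) nu%:R * e nu.
  by apply: sumr_ge0 => nu _; rewrite mulr_ge0.
have [->|t0] := eqVneq t 0.
  apply: dominated_le (dominated0 alpha p1) _ _ => [|x x11].
    rewrite lee_fin; apply: mulr_ge0 (S0 _); apply: divr_ge0 (sqr_ge0 _).
    by apply: mulr_ge0; [exact: ler0n|exact: ltW].
  by rewrite gen_translation0// subee.
have st := sin_neq0 t1 t0.
have [P PP] := choice eP.
have /andP[k1 k2] := trunc_log_bounds (isT : 1 < 2)%N n0.
set k := trunc_log 2 n in k1 k2.
have wP m : (wnorm (fun x => g x - (P m).[x])%R <= (e m)%:E)%E.
  by rewrite -(weighted_norm_version p1 a0 mg mN N0 gf); have [] := PP m.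
have sP m : (0 < m)%N -> (size (P m) <= m)%N by have [] := PP m.
have dd := dominated_dyadic k mg e0 edec sP (fun m _ => wP m) t1.
have dT := dominated_gen_translationB p1 C0 C_bound st mg dd.
apply: (dominated_version p1 mg mN N0 gf st).
apply: dominated_le dT _ (fun x _ => lexx _).
apply: (@le_trans _ _ (D * e (2 ^ k)%N + 128 * D * t ^+ 2 * \sum_(j < k) 4 ^+ j * e (2 ^ j)%N)%:E).
  rewrite -/D [leRHS]EFinD; apply: leeD; last exact: lexx.
  by rewrite EFinM; apply: lee_wpmul2l; [rewrite lee_fin ltW|exact: wP].
rewrite lee_fin.
have n2 : 0 < n%:R ^+ 2 :> R by rewrite exprn_gt0.
have A0 : 0 <= \sum_(j < k) 4 ^+ j * e (2 ^ j)%N.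
  by apply: sumr_ge0 => j _; rewrite mulr_ge0// exprn_ge0.
have t2 : t ^+ 2 <= (n%:R ^+ 2)^-1.
  by rewrite -exprVn -real_normK ?num_real// lerXn2r// nnegrE invr_ge0 ltW.
have nk : n%:R ^+ 2 <= 4 * 4 ^+ k :> R.
  have -> : 4 * 4 ^+ k = ((2 ^ k.+1)%N%:R : R) ^+ 2.
    by rewrite -exprS natrX -exprM mulnC exprM; congr (_ ^+ _); ring.
  by rewrite lerXn2r ?nnegrE// ler_nat ltnW.
have := dyadic_sum_le e0 edec k; rewrite big_ord_recr/=.
have : \sum_(1 <= nu < (2 ^ k).+1) nu%:R * e nu <= \sum_(1 <= nu < n.+1) nu%:R * e nu.
  rewrite [leRHS](@big_cat_nat _ _ _ (2 ^ k).+1)//= ?ltnS// lerDl.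
  by apply: sumr_ge0 => nu _; rewrite mulr_ge0.
move: (\sum_(j < k) _) A0 (\sum_(1 <= nu < (2 ^ k).+1) _) (\sum_(1 <= nu < n.+1) _) => A A0 S1 S S1S AS.
have ek := e0 (2 ^ k)%N; move: (e (2 ^ k)%N) ek AS => E E0 AS.
set i := (n%:R ^+ 2)^-1 in t2 *; have i0 : 0 < i by rewrite invr_gt0.
have nk1 : 1 <= i * (4 * 4 ^+ k) by rewrite mulrC ler_pdivlMr// mul1r.
(* Since [n ^ 2 <= 4 * 4 ^ k], the approximation error at degree [2 ^ k] fits into the missing term
   [j = k] of the dyadic sum. The factor 4 of [dyadic_sum_le] then makes [512 = 128 * 4]. *)
have b1 : D * E <= 128 * D * i * (4 ^+ k * E).
  have : 0 <= D * E by rewrite mulr_ge0// ltW.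
  have : 0 <= D * E * i * 4 ^+ k by rewrite !mulr_ge0 ?exprn_ge0 ?(ltW i0) ?(ltW D0).
  by move=> X /ler_wpM2l /(_ _ _ nk1); lra.
have b2 : 128 * D * t ^+ 2 * A <= 128 * D * i * A.
  by rewrite ler_wpM2r// ler_wpM2l// mulr_ge0// ltW.
have : 0 <= 128 * D * i by rewrite mulr_ge0 ?(ltW i0)// mulr_ge0// ltW.
move=> /ler_wpM2l b3; have := b3 _ _ AS; have := b3 _ _ S1S; lra.
Qed.

Lemma gen_modulus_le f n : in_Lw p alpha f -> (0 < n)%N ->
  (gen_modulus p alpha f (1 / n%:R) <=
   (512 * D / n%:R ^+ 2)%:E * \sum_(1 <= nu < n.+1) nu%:R%:E * best_approx p alpha f nu)%E.
Proof.
move=> fL n0; have [g [N [mg mN N0 gf]]] := in_Lw_borel fL.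
pose c := 512 * D / n%:R ^+ 2; rewrite -/c.
have c0 : 0 < c.
  by apply: divr_gt0; [apply: mulr_gt0 D0; exact: ltr0Sn|rewrite exprn_gt0// ltr0n].
pose T : R := \sum_(1 <= nu < n.+1) nu%:R.
have T0 : 0 < T.
  rewrite /T big_ltn ?ltnS// ltr_pwDl ?ltr01// sumr_ge0// => nu _.
(* The infima need not be attained. Each is relaxed by the same [d], which keeps the sequence
   nonincreasing and costs [c * T * d = eps] in total. *)
apply/lee_addgt0Pr => eps eps0; pose d := eps / (c * T).
have d0 : 0 < d by rewrite divr_gt0// mulr_gt0.
pose E nu := fine (best_approx p alpha f nu).
have EE nu : (best_approx p alpha f nu = (E nu)%:E) by rewrite fineK// best_approx_fin.
have E0 nu : 0 <= E nu by rewrite -lee_fin -EE best_approx_ge0.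
pose e nu := E nu + d.
have e0 nu : 0 <= e nu by rewrite addr_ge0// ltW.
have edec a b : (0 < a <= b)%N -> e b <= e a.
  by move=> /andP[_ ab]; rewrite lerD2r -lee_fin -!EE best_approx_decr.
have eP nu : exists P : {poly R}, (size P <= nu)%N /\
     (weighted_norm p alpha (fun x => (f x - P.[x])%:E) <= (e nu)%:E)%E.
  have [_ [P sP <-] /ltW Pe] := lb_ereal_inf_adherent d0 (best_approx_fin nu fL).
  by exists P; split => //; rewrite EFinD -EE.
have -> : (c%:E * (\sum_(1 <= nu < n.+1) nu%:R%:E * best_approx p alpha f nu) + eps%:E =
    (c * \sum_(1 <= nu < n.+1) nu%:R * e nu)%:E)%E.
  under eq_bigr do rewrite EE -EFinM.
  rewrite sumEFin -EFinM -EFinD; congr EFin.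
  have -> : eps = c * (T * d) by rewrite /d; field; rewrite !gt_eqF.
  rewrite -mulrDr; congr (c * _); rewrite mulr_suml -big_split/=.
  by apply: eq_bigr => nu _; rewrite /e mulrDr.
apply: ge_ereal_sup => _ [t /= tn <-].
apply: dominated_weighted_norm => //.
by apply: (dominated_translationB mg mN N0 gf n0 e0 edec eP); rewrite -div1r.
Qed.

End assembly.

Theorem theorem2p1 (R : realType) (p : \bar R) (alpha lambda : R)
    (hp : (1 <= p)%E)
    (hlambda : 0 < lambda < 2)
    (halpha_1 : p = 1%E -> 1 / 2 < alpha <= 1)
    (halpha_fin : (1 < p < +oo)%E ->
      1 - 1 / (2 * fine p) < alpha < 3 / 2 - 1 / (2 * fine p))
    (halpha_oo : p = +oo%E -> 1 <= alpha < 3 / 2) :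
  exists C : R, forall f : R -> R, in_Lw p alpha f ->
    forall n : nat, (0 < n)%N ->
      (gen_modulus p alpha f (1 / n%:R) <=
       (C / n%:R ^+ 2)%:E *
         \sum_(1 <= nu < n.+1) nu%:R%:E * best_approx p alpha f nu)%E.
Proof.
have [C C0 CP] := weighted_circle_mean_bounded hp halpha_1 halpha_fin halpha_oo.
have a0 : 0 < alpha.
  case: p hp halpha_1 halpha_fin halpha_oo {CP} => [r|_ _ _ /(_ erefl)|//]; last by lra.
  rewrite lee_fin le_eqVlt => /predU1P[<- /(_ erefl)|r1 _ h _]; first by lra.
  have : 1 / (2 * r) < 1 by rewrite ltr_pdivrMr; lra.
  have := h; rewrite lte_fin r1 ltry => /(_ isT) /=; lra.
exists (512 * (1 + 5 / pi * C)) => f fL n n0.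
exact: (gen_modulus_le hp a0 C0 CP).
Qed.
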